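(* For every $\alpha>3/2$ there exists a constant $C>0$ depending only on $\alpha$ such that the following holds. Let $n,d_1,d_2\ge2$ and $K\ge1$ be integers, let $d=\max(d_1,d_2)$, and let the estimator $\widehat P^*$ be the output of $\mathrm{Alg1}(\alpha,d,N,n,H^{(1)},H^{(2)})$ with $N=\max(d,n)$. Then $$\sup_{P\in\mathcal{T}_K}\ \mathbb{E}_P\|\widehat P^*-P\|_1\ \le\ C\,\min\Big\{\sqrt{\tfrac{Kd}{n}}\,(\log n)^{3/2},\ 1\Big\}.$$
   Context: $\mathcal{T}_K$ is the set of all matrices $P\in\mathbb{R}^{d_1\times d_2}$ with rank at most $K$, nonnegative entries, and $\sum_{i,j}P_{ij}=1$. One observes $2n$ iid random variables $X_1,\dots,X_{2n}$ with $\mathbb{P}_P(X_k=(i,j))=P_{ij}$, $(i,j)\in\{1,\dots,d_1\}\times\{1,\dots,d_2\}$; $\mathbb{E}_P$ is the corresponding expectation. The $d_1\times d_2$ matrices of empirical frequencies are $H^{(1)}_{ij}=\frac1n\#\{k\le n: X_k=(i,j)\}$ and $H^{(2)}_{ij}=\frac1n\#\{n<k\le 2n: X_k=(i,j)\}$. $\|\cdot\|_1$ is the entrywise $\ell_1$ norm, $\|\cdot\|_F$ the Frobenius norm, $\|\cdot\|_*$ the nuclear norm; $\log$ is the natural logarithm. Definition of $\mathrm{Alg1}(\alpha,d,N,n,H^{(1)},H^{(2)})$: (1) If $n<14\,\alpha\, d\log N$, output $\widehat P^*=\frac12(H^{(1)}+H^{(2)})$. (2) Otherwise set $T=\lfloor\log_2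 d\rfloor-1$. Let $\widehat L_i$ and $\widehat C_j$ be the $i$-th row and $j$-th column of $H^{(1)}$. For $t\in\{0,\dots,T\}$ set $I_t=\{i:\|\widehat L_i\|_1\in(2^{-t-1},2^{-t}]\}$ and $J_t=\{j:\|\widehat C_j\|_1\in(2^{-t-1},2^{-t}]\}$; set $I_{T+1}=\{i:\|\widehat L_i\|_1\le2^{-T-1}\}$ and $J_{T+1}=\{j:\|\widehat C_j\|_1\le2^{-T-1}\}$. (3) For each $k=(t,t')\in\{0,\dots,T+1\}^2$ let $M^{(k)}$ be the $d_1\times d_2$ matrix with entries $H^{(2)}_{ij}\mathbf{1}\{i\in I_t,\ j\in J_{t'}\}$, let $\tau_k=12\sqrt{\alpha\frac{\log N}{n}2^{-\min(t,t')}}$, and let $\widehat P^{(k)}=\arg\min_{A\in\mathbb{R}^{d_1\times d_2}}\big(\|M^{(k)}-A\|_F^2+\tau_k\|A\|_*\big)$. (4) Let $\widehat P=\sum_{k\in\{0,\dots,T+1\}^2}\widehat P^{(k)}$ and $\widehat P_+=(\max(\widehat P_{ij},0))_{ij}$. If $\widehat P_+=0$, output $\widehat P^*=\frac12(H^{(1)}+H^{(2)})$; otherwise output $\widehat P^*=\widehat P_+/\|\widehat P_+\|_1$. *)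

(* Defs.v *)
From HB Require Import structures.
From mathcomp Require Export all_boot all_order all_algebra.
From mathcomp Require Export polyrcf.
From mathcomp Require Export all_classical all_reals all_analysis.

Set Implicit Arguments.
Unset Strict Implicit.
Unset Printing Implicit Defensive.

Import Order.TTheory GRing.Theory Num.Theory.

Local Open Scope classical_set_scope.
Local Open Scope ring_scope.

Section matrix_norms.
Context {R : realType} {d1 d2 : nat}.
Implicit Types A B M : 'M[R]_(d1, d2).

Definition norm1 A : R := \sum_i \sum_j `|A i j|.

Definition normF A : R := Num.sqrt (\sum_i \sum_j A i j ^+ 2).

(* Sum of the singular values of A, i.e. of the square roots of the eigenvalues
   of A^T A.  The eigenvalues are enumerated without repetition by [rootsR]
   and weighted by their multiplicity in the characteristic polynomial; if
   d2 > d1 the surplus eigenvalues are zero and do not contribute. *)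
Definition nuclear_norm A : R :=
  let p := char_poly (A^T *m A) in
  \sum_(x <- rootsR p) (mup x p)%:R * Num.sqrt x.

Definition penalized_loss (tau : R) M A : R :=
  normF (M - A) ^+ 2 + tau * nuclear_norm A.

(* For tau >= 0 the loss is strictly convex and coercive, so the minimizer
   exists and is unique: the choice made by [xget] and its default value 0 are
   immaterial. *)
Definition nuclear_prox (tau : R) M : 'M[R]_(d1, d2) :=
  xget 0 [set A | forall B, penalized_loss tau M A <= penalized_loss tau M B].

Definition low_rank_distributions (K : nat) : set 'M[R]_(d1, d2) :=
  [set P | [/\ (\rank P <= K)%N, forall i j, 0 <= P i j
             & \sum_i \sum_j P i j = 1]].

End matrix_norms.

Section algorithm.
Context {R : realType} {d1 d2 : nat}.
Implicit Types H M : 'M[R]_(d1, d2).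

Definition last_level (d : nat) : nat := (trunc_log 2 d).-1.

(* With T = last_level d, a line (row or column) of l1-norm x has level t <= T
   when x lies in (2^(-t-1), 2^(-t)], and level T + 1 when x <= 2^(-T-1). *)
Definition in_level (T t : nat) (x : R) : bool :=
  if (t <= T)%N then 2 ^- t.+1 < x <= 2 ^- t else x <= 2 ^- T.+1.

Definition row_level (T t : nat) H : {set 'I_d1} :=
  [set i | in_level T t (norm1 (row i H))].

Definition col_level (T t : nat) H : {set 'I_d2} :=
  [set j | in_level T t (norm1 (col j H))].

Definition level_block (T t t' : nat) H1 H2 : 'M[R]_(d1, d2) :=
  \matrix_(i, j) (if (i \in row_level T t H1) && (j \in col_level T t' H1)
                  then H2 i j else 0).

Definition threshold (alpha : R) (N n t t' : nat) : R :=
  12 * Num.sqrt (alpha * (ln N%:R / n%:R) * 2 ^- minn t t').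

Definition block_sum (alpha : R) (d N n : nat) H1 H2 : 'M[R]_(d1, d2) :=
  let T := last_level d in
  \sum_(t < T.+2) \sum_(t' < T.+2)
    nuclear_prox (threshold alpha N n t t') (level_block T t t' H1 H2).

Definition pos_part M : 'M[R]_(d1, d2) := map_mx (Num.max^~ 0) M.

Definition alg1 (alpha : R) (d N n : nat) H1 H2 : 'M[R]_(d1, d2) :=
  let P := pos_part (block_sum alpha d N n H1 H2) in
  if (n%:R < 14 * alpha * d%:R * ln N%:R) || (P == 0)
  then 2^-1 *: (H1 + H2)
  else (norm1 P)^-1 *: P.

End algorithm.

Section sampling.
Context {R : realType} {disp : measure_display} {Omega : measurableType disp}.

Definition mutually_independent (I U : finType) (Pr : probability Omega R)
    (X : I -> Omega -> U) : Prop :=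
  forall (S : {set I}) (B : I -> set U),
    Pr (\bigcap_(k in [set` S]) (X k @^-1` B k)) =
    (\prod_(k in S) Pr (X k @^-1` B k))%E.

(* As X takes values in a finite set, preimages of points determine both its
   measurability and its law. *)
Definition iid_sample (d1 d2 m : nat) (P : 'M[R]_(d1, d2))
    (Pr : probability Omega R) (X : 'I_m -> Omega -> 'I_d1 * 'I_d2) : Prop :=
  [/\ forall k ij, measurable (X k @^-1` [set ij]),
      forall k ij, Pr (X k @^-1` [set ij]) = (P ij.1 ij.2)%:E
    & mutually_independent Pr X].

(* Observations are numbered from 0: the first half of the sample is k < n. *)
Definition freq1 (d1 d2 n : nat) (X : 'I_(2 * n) -> Omega -> 'I_d1 * 'I_d2)
    (w : Omega) : 'M[R]_(d1, d2) :=
  \matrix_(i, j)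
    (#|[set k : 'I_(2 * n) | (k < n)%N & X k w == (i, j)]|%:R / n%:R).

Definition freq2 (d1 d2 n : nat) (X : 'I_(2 * n) -> Omega -> 'I_d1 * 'I_d2)
    (w : Omega) : 'M[R]_(d1, d2) :=
  \matrix_(i, j)
    (#|[set k : 'I_(2 * n) | (n <= k)%N & X k w == (i, j)]|%:R / n%:R).

End sampling.

(* Main.v *)
Require Import Defs.
From mathcomp Require Import ring lra zify.
From mathcomp Require Import complex measurable_realfun.

(** Why the bound holds.

    The loss never exceeds 2, and when [n < 14 alpha d log N] the rate is itself
    bounded from below, so only the case [n >= 14 alpha d log n] matters; there
    [d <= n] and [N = n].

    The first half of the sample sorts rows and columns into dyadic levels. By a
    binomial lower tail ([expect_few_hits]), with probability at least
    [1 - 2 d n^-2] no line of mass above [2^-T] looks more than twice too light, so in the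
    block of level [(t, t')] all true row sums are at most [2 * 2^-t] and all
    true column sums at most [2 * 2^-t'].

    Given the levels, the noise of the second half on a block is a centered sum
    of independent matrix units, of variance at most of order
    [2^-min(t,t') / n]. Its operator norm is controlled through a high moment of
    its Hermitian dilation [W]. Redrawing one observation gives an exchangeable
    pair, and [expect_trace_power] derives from it a bound of [tr W^(2p)] by the
    moments of the quadratic variation. The square of the dilation of a matrix
    unit is diagonal, so the quadratic variation is a vector of binomial counts,
    with moments bounded by [expect_hits_moment]. With [p] close to [2 log n],
    [level_block_tail] shows that the noise is below half of the penalty level
    [tau] up to a probability of order [d n^-2].

    On that event the penalized estimator of the block is explicit. It is soft
    thresholding of the singular values at [tau / 2], which is proved optimal by
    the duality of the operator and nuclear norms ([svt_minimizes]). It has rank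
    at most [K] ([rank_svt]) and is [tau]-close to the true block in operator
    norm, hence its squared Frobenius error is at most [2 K tau^2]
    ([nuclear_prox_error]). The block has at most [2^(t+1)] rows and [2^(t'+1)]
    columns, so by Cauchy-Schwarz its l1 error is of order
    [sqrt (2^max(t,t') K log n / n)]. The sum over the levels is at most of order
    [log d * sqrt (K d log n / n)] ([block_sum_error]). Taking the positive part
    and renormalizing costs a factor 2. *)

Set Implicit Arguments.
Unset Strict Implicit.
Unset Printing Implicit Defensive.

Import Order.TTheory GRing.Theory Num.Theory.
Local Open Scope ring_scope.

(** * Spectral theorem for real symmetric matrices *)

(** Over the complex extension [A] is Hermitian, so it has an eigenvalue, and
    that eigenvalue is real; a real root of the characteristic polynomial has
    an eigenvector with real entries. *)
Lemma symmetric_eigenvector (R : rcfType) n (A : 'M[R]_n.+1) :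
  A^T = A -> exists a (v : 'cV[R]_n.+1), v != 0 /\ A *m v = a *: v.
Proof.
move=> symA.
pose AC := map_mx (real_complex R) A.
have hermAC : AC \is hermsymmx.
  apply: realsym_hermsym; first by apply/is_hermitianmxP; rewrite expr0 scale1r map_mx_id // map_trmx symA.
  by apply/mxOverP => i j; rewrite mxE complex_real.
have PU := spectral_unit AC.
have /orthomx_spectralP E := hermitian_normalmx hermAC.
have /mxOverP/(_ 0 0) := hermitian_spectral_diag_real hermAC.
set P := spectralmx AC in E PU *; set D := spectral_diag AC in E *.
move=> /complex_realP[a Da].
have : eigenvalue AC a%:C%C.
  apply/eigenvalueP; exists (row 0 P).
    rewrite -row_mul [in LHS]E !mulmxA mulmxV // mul1mx row_mul row_diag_mx.
    by rewrite -scalemxAl -rowE Da.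
  apply/eqP => row0.
  have : row 0 P *m invmx P = 0 by rewrite row0 mul0mx.
  rewrite -row_mul mulmxV // => /matrixP/(_ 0 0)/eqP.
  by rewrite !mxE eqxx oner_eq0.
rewrite eigenvalue_root_char -map_char_poly fmorph_root -eigenvalue_root_char.
move=> /eigenvalueP[v vA v0]; exists a, v^T; split; first by rewrite trmx_eq0.
by rewrite -[in LHS]symA -trmx_mul vA linearZ.
Qed.

Lemma col_sqnormE (R : rcfType) n (v : 'cV[R]_n) :
  (v^T *m v) 0 0 = \sum_i v i 0 ^+ 2.
Proof. by rewrite mxE; apply: eq_bigr => i _; rewrite mxE expr2. Qed.

Lemma col_sqnorm_eq0 (R : rcfType) n (v : 'cV[R]_n) :
  ((v^T *m v) 0 0 == 0) = (v == 0).
Proof.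
rewrite col_sqnormE psumr_eq0; last by move=> i _; exact: sqr_ge0.
apply/idP/eqP => [/allP h|->]; last first.
  by apply/allP => i _; rewrite mxE expr0n eqxx.
apply/matrixP => i j; rewrite (ord1 j) mxE; apply/eqP.
by have := h i (mem_index_enum _); rewrite sqrf_eq0.
Qed.

(** The reflection in the hyperplane orthogonal to [v - e_0] exchanges the unit
    vectors [v] and [e_0]. *)
Lemma householder (R : rcfType) n (v : 'cV[R]_n.+1) :
  (v^T *m v) 0 0 = 1 ->
  exists Q : 'M[R]_n.+1, [/\ Q^T = Q, Q *m Q = 1%:M & Q *m delta_mx 0 0 = v].
Proof.
move=> v1; pose e : 'cV[R]_n.+1 := delta_mx 0 0.
have [ve|nve] := eqVneq v e.
  by exists 1%:M; rewrite trmx1 !mul1mx ve.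
pose w : 'cV[R]_n.+1 := v - e.
have wT : w^T = v^T - e^T by rewrite linearB.
have vTe : v^T *m e = (v 0 0)%:M.
  by apply/matrixP => i j; rewrite !ord1 -colE !mxE eqxx mulr1n.
have eTv : e^T *m v = (v 0 0)%:M.
  by rewrite -[LHS]trmxK trmx_mul trmxK vTe tr_scalar_mx.
have eTe : e^T *m e = 1%:M.
  by rewrite trmx_delta mul_delta_mx; apply/matrixP => i j; rewrite !ord1 !mxE.
have vTv : v^T *m v = 1%:M.
  by apply/matrixP => i j; rewrite !ord1 v1 mxE.
have wTw : w^T *m w = (2 - 2 * v 0 0)%:M.
  rewrite wT mulmxBl !mulmxBr vTv vTe eTv eTe.
  by apply/matrixP => i j; rewrite !ord1 !mxE eqxx !mulr1n; ring.
have c0 : 2 - 2 * v 0 0 != 0.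
  have : (w^T *m w) 0 0 != 0 by rewrite col_sqnorm_eq0 subr_eq0.
  by rewrite wTw mxE eqxx mulr1n.
pose c := 2 / (2 - 2 * v 0 0).
pose Q : 'M[R]_n.+1 := 1%:M - c *: (w *m w^T).
have Qsym : Q^T = Q.
  by rewrite linearB linearZ /= trmx_mul trmxK trmx1.
have QQ : Q *m Q = 1%:M.
  pose B := w *m w^T.
  have BB : B *m B = (2 - 2 * v 0 0) *: B.
    by rewrite mulmxA -(mulmxA w) wTw mul_mx_scalar scalemxAl.
  have cc : c * c * (2 - 2 * v 0 0) = 2 * c by rewrite /c; field.
  rewrite /Q -/B mulmxBl mul1mx !mulmxBr mulmx1 -!scalemxAl -!scalemxAr BB.
  rewrite !scalerA cc; move: (1%:M : 'M[R]_n.+1) => I1; clearbody B.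
  by apply/matrixP => i j; rewrite !mxE; ring.
exists Q; split => //.
have Qv : Q *m v = e.
  rewrite mulmxBl mul1mx -scalemxAl -mulmxA.
  have -> : w^T *m v = (1 - v 0 0)%:M.
    rewrite wT mulmxBl vTv eTv.
    by apply/matrixP => i j; rewrite !ord1 !mxE eqxx !mulr1n.
  rewrite mul_mx_scalar scalerA.
  have -> : c * (1 - v 0 0) = 1 by rewrite /c; field.
  by rewrite scale1r /w opprB addrCA subrr addr0.
by rewrite -/e -Qv mulmxA QQ mul1mx.
Qed.

(** Conjugating by a reflection that moves a unit eigenvector to the first axis
    splits off one eigenvalue and leaves a smaller symmetric block. *)
Theorem symmetric_diagonalization (R : rcfType) n (A : 'M[R]_n) :
  A^T = A ->
  exists (Q : 'M[R]_n) (D : 'rV[R]_n),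
    [/\ Q^T *m Q = 1%:M, Q *m Q^T = 1%:M & A = Q *m diag_mx D *m Q^T].
Proof.
elim: n A => [|n IH] A symA.
  by exists 1%:M, 0; split; apply/matrixP => [[]].
have [a [u [u0 Au]]] := symmetric_eigenvector symA.
pose c := Num.sqrt ((u^T *m u) 0 0).
have uu0 : 0 < (u^T *m u) 0 0.
  rewrite lt0r col_sqnorm_eq0 u0 col_sqnormE; apply: sumr_ge0 => i _.
  exact: sqr_ge0.
have c0 : c != 0 by rewrite sqrtr_eq0 -ltNge.
have [|P [PT PP Pe]] := @householder R n (c^-1 *: u).
  have -> : (c^-1 *: u)^T = c^-1 *: u^T by apply/matrixP => i j; rewrite !mxE.
  rewrite -scalemxAl -scalemxAr scalerA; move: (u^T *m u) @c uu0 c0 => s c s0 c0.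
  by rewrite mxE -(sqr_sqrtr (ltW s0)) -/c; field.
pose B : 'M[R]_(1 + n) := P *m A *m P.
have Be : B *m delta_mx 0 0 = a *: (delta_mx 0 0 : 'cV_(1 + n)).
  rewrite /B -!mulmxA Pe -scalemxAr Au scalerA mulrC -scalerA -Pe -scalemxAr.
  by rewrite mulmxA PP mul1mx.
have BT : B^T = B by rewrite /B !trmx_mul PT symA mulmxA.
have Bl : lsubmx B = col_mx a%:M 0.
  apply/matrixP => i j; rewrite !ord1 mxE.
  have /matrixP/(_ i 0) := Be; rewrite -colE !mxE.
  have -> : lshift n 0 = 0 :> 'I_(1 + n) by apply: val_inj.
  move=> ->; case: (splitP i) => k ik.
    rewrite ord1 mxE eqxx mulr1n; have -> : i == 0 by rewrite -val_eqE /= ik ord1.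
    by rewrite mulr1.
  by rewrite mxE -val_eqE /= ik mulr0.
have Bul : ulsubmx B = a%:M.
  apply/matrixP => i j; have /matrixP/(_ (lshift n i) j) := Bl.
  by rewrite col_mxEu => <-; rewrite !mxE.
have Bdl : dlsubmx B = 0.
  apply/matrixP => i j; have /matrixP/(_ (rshift 1 i) j) := Bl.
  by rewrite col_mxEd => <-; rewrite !mxE.
have Bur : ursubmx B = 0 by rewrite -BT -trmx_dlsub Bdl trmx0.
pose B' := drsubmx B.
have B'T : B'^T = B' by rewrite /B' trmx_drsub BT.
have [Q' [D' [Q1 Q2 BE]]] := IH _ B'T.
have BB : B = block_mx a%:M 0 0 B'.
  by rewrite -[LHS]submxK Bul Bur Bdl.
pose Q : 'M[R]_(1 + n) := block_mx 1%:M 0 0 Q'.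
have QT : Q^T = block_mx 1%:M 0 0 Q'^T.
  by rewrite tr_block_mx trmx1 !trmx0.
have QQ1 : Q^T *m Q = 1%:M.
  by rewrite QT mulmx_block !mulmx0 !mul0mx !addr0 mul1mx add0r Q1 -scalar_mx_block.
have QQ2 : Q *m Q^T = 1%:M.
  by rewrite QT mulmx_block !mulmx0 !mul0mx !addr0 mul1mx add0r Q2 -scalar_mx_block.
exists (P *m Q), (row_mx a%:M D'); split.
- by rewrite trmx_mul PT -mulmxA (mulmxA P) PP mul1mx QQ1.
- by rewrite trmx_mul PT mulmxA -(mulmxA P Q) QQ2 mulmx1 PP.
have AE : A = P *m B *m P.
  by rewrite /B !mulmxA PP mul1mx -mulmxA PP mulmx1.
suff BQ : B = Q *m diag_mx (row_mx a%:M D') *m Q^T.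
  by rewrite trmx_mul PT AE BQ !mulmxA.
rewrite BB QT diag_mx_row /Q !mulmx_block !mulmx0 !mul0mx !addr0 !add0r.
rewrite !mul1mx !mul0mx mulmx1 -BE.
by congr block_mx; apply/matrixP => i j; rewrite !ord1 !mxE ?eqxx.
Qed.

(** * Frobenius, operator and nuclear norms *)

(** Lagrange's identity: the defect in the Cauchy-Schwarz inequality is half
    the sum of the squares of all two by two minors. *)
Lemma sqr_sum_mul_le (R : realFieldType) (I : finType) (a b : I -> R) :
  (\sum_i a i * b i) ^+ 2 <= (\sum_i a i ^+ 2) * (\sum_i b i ^+ 2).
Proof.
rewrite -subr_ge0.
suff -> : (\sum_i a i ^+ 2) * (\sum_i b i ^+ 2) - (\sum_i a i * b i) ^+ 2
    = 2^-1 * \sum_i \sum_j (a i * b j - a j * b i) ^+ 2.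
  rewrite mulr_ge0 ?invr_ge0 //; apply: sumr_ge0 => i _; apply: sumr_ge0 => j _.
  exact: sqr_ge0.
have E (i j : I) : (a i * b j - a j * b i) ^+ 2 =
    a i ^+ 2 * b j ^+ 2 + (b i ^+ 2 * a j ^+ 2
    - 2 * (a i * b i) * (a j * b j)) by ring.
set x := \sum_i a i ^+ 2; set y := \sum_i b i ^+ 2; set z := \sum_i a i * b i.
have -> : \sum_i \sum_j (a i * b j - a j * b i) ^+ 2 =
    \sum_i (a i ^+ 2 * y + (b i ^+ 2 * x - 2 * (a i * b i) * z)).
  apply: eq_bigr => i _; under eq_bigr do rewrite E.
  by rewrite big_split sumrB -!mulr_sumr.
rewrite big_split sumrB -!mulr_suml /= -mulr_sumr -/x -/y -/z; by field.
Qed.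

Definition frob2 (R : realType) m n (A : 'M[R]_(m, n)) : R :=
  \sum_i \sum_j A i j ^+ 2.

(** For [0 <= l], this says that the operator norm of [A] is at most [l]. *)
Definition opbound (R : realType) m n (l : R) (A : 'M[R]_(m, n)) : Prop :=
  forall x : 'cV[R]_n, frob2 (A *m x) <= l ^+ 2 * frob2 x.

Section Frobenius.
Context {R : realType}.

Lemma frob2_ge0 m n (A : 'M[R]_(m, n)) : 0 <= frob2 A.
Proof. by apply: sumr_ge0 => i _; apply: sumr_ge0 => j _; exact: sqr_ge0. Qed.

Lemma frob2_eq0 m n (A : 'M[R]_(m, n)) : (frob2 A == 0) = (A == 0).
Proof.
apply/idP/eqP => [|->]; last first.
  by apply/eqP; rewrite /frob2 big1 // => i _; rewrite big1 // => j _; rewrite mxE expr0n.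
rewrite psumr_eq0; last by move=> i _; apply: sumr_ge0 => j _; exact: sqr_ge0.
move=> /allP h; apply/matrixP => i j; rewrite mxE; apply/eqP.
have /= := h i (mem_index_enum _); rewrite psumr_eq0; last by move=> ? _; exact: sqr_ge0.
by move=> /allP/(_ j (mem_index_enum _)) /=; rewrite sqrf_eq0.
Qed.

Lemma normF_sqr m n (A : 'M[R]_(m, n)) : normF A ^+ 2 = frob2 A.
Proof. exact/sqr_sqrtr/frob2_ge0. Qed.

Lemma frob2E m n (A : 'M[R]_(m, n)) : frob2 A = \tr (A^T *m A).
Proof.
rewrite /frob2 exchange_big; apply: eq_bigr => j _; rewrite mxE.
by apply: eq_bigr => i _; rewrite mxE expr2.
Qed.

Lemma frob2_col n (x : 'cV[R]_n) : frob2 x = \sum_i x i 0 ^+ 2.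
Proof. by apply: eq_bigr => i _; rewrite big_ord1. Qed.

Lemma frob2D m n (A B : 'M[R]_(m, n)) :
  frob2 (A + B) = frob2 A + 2 * \tr (A^T *m B) + frob2 B.
Proof.
have -> : \tr (A^T *m B) = (\tr (A^T *m B) + \tr (B^T *m A)) / 2.
  have -> : \tr (B^T *m A) = \tr (A^T *m B) by rewrite -mxtrace_tr trmx_mul trmxK.
  by field.
rewrite !frob2E [(A + B)^T]raddfD mulmxDl !mulmxDr !mxtraceD.
by field.
Qed.

Lemma opboundD m n l k (A B : 'M[R]_(m, n)) :
  0 <= l -> 0 <= k -> opbound l A -> opbound k B -> opbound (l + k) (A + B).
Proof.
move=> l0 k0 hA hB x; rewrite mulmxDl.
have nn := frob2_ge0 x.
have sq (C : 'M[R]_(m, n)) h : 0 <= h -> opbound h C ->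
    Num.sqrt (frob2 (C *m x)) <= h * Num.sqrt (frob2 x).
  move=> h0 hC; rewrite -(ger0_norm h0) -sqrtr_sqr -sqrtrM ?sqr_ge0 //.
  exact: ler_wsqrtr.
have cs : \tr ((A *m x)^T *m (B *m x)) <=
    Num.sqrt (frob2 (A *m x)) * Num.sqrt (frob2 (B *m x)).
  rewrite -sqrtrM ?frob2_ge0 // (le_trans (ler_norm _)) // -sqrtr_sqr.
  apply: ler_wsqrtr; rewrite /mxtrace big_ord1 mxE.
  have := sqr_sum_mul_le (fun i => (A *m x) i 0) (fun i => (B *m x) i 0).
  rewrite -!frob2_col; congr (_ ^+ 2 <= _).
  by apply: eq_bigr => i _; rewrite [(A *m x)^T _ _]mxE.
have a0 := sqrtr_ge0 (frob2 (A *m x)); have b0 := sqrtr_ge0 (frob2 (B *m x)).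
have := sq _ _ l0 hA; have := sq _ _ k0 hB; have s0 := sqrtr_ge0 (frob2 x).
rewrite frob2D -(sqr_sqrtr (frob2_ge0 (A *m x))) -(sqr_sqrtr (frob2_ge0 (B *m x))).
rewrite -{3}(sqr_sqrtr nn) -exprMn mulrDl.
move: cs a0 b0; set t := \tr _; set a := Num.sqrt _; set b := Num.sqrt _.
set s := Num.sqrt _ in s0 * => cs a0 b0 hb ha.
apply: (@le_trans _ _ ((a + b) ^+ 2)); first by rewrite sqrrD; lra.
move: ha hb; rewrite !sqrtr_sqr !ger0_norm // => ha hb.
by rewrite lerXn2r ?nnegrE ?addr_ge0 ?mulr_ge0 ?addr_ge0 // mulrDl lerD.
Qed.

End Frobenius.

(** Similarity turns the characteristic polynomial of [A^T *m A] into the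
    product of the [X - D_i], so the multiplicities of its roots count the
    repetitions in the list of eigenvalues. *)
Lemma nuclear_normE (R : realType) d1 d2 (A : 'M[R]_(d1, d2)) Q (D : 'rV[R]_d2) :
  Q^T *m Q = 1%:M -> A^T *m A = Q *m diag_mx D *m Q^T ->
  nuclear_norm A = \sum_i Num.sqrt (D 0 i).
Proof.
move=> QQ E.
pose s := [seq D 0 i | i <- index_enum 'I_d2].
have pE : char_poly (A^T *m A) = \prod_(y <- s) ('X - y%:P).
  have -> : \prod_(y <- s) ('X - y%:P) = \prod_i ('X - (diag_mx D i i)%:P).
    by rewrite big_map; apply: eq_bigr => i _; rewrite mxE eqxx mulr1n.
  rewrite -char_poly_trig; last exact/is_diag_mx_is_trig/diag_mx_is_diag.
  rewrite E /char_poly /char_poly_mx.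
  have QQP : map_mx polyC Q *m map_mx polyC Q^T = 1%:M.
    by rewrite -map_mxM mulmx1C // map_mx1.
  have -> : 'X%:M - map_mx polyC (Q *m diag_mx D *m Q^T) = map_mx polyC Q *m
      ('X%:M - map_mx polyC (diag_mx D)) *m map_mx polyC Q^T.
    rewrite mulmxBr mulmxBl !map_mxM; congr (_ - _).
    by rewrite mul_mx_scalar -scalemxAl QQP scale_scalar_mx mulr1.
  rewrite !det_mulmx mulrAC -det_mulmx QQP det1 mul1r //.
rewrite /nuclear_norm pE.
have p0 : \prod_(y <- s) ('X - y%:P) != 0.
  by rewrite monic_neq0 // monic_prod_XsubC.
set p := \prod_(y <- s) _ in p0 *.
under eq_bigr do rewrite mu_prod_XsubC -sum1_count natr_sum big_mkcond mulr_suml.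
rewrite exchange_big big_map /=; apply: eq_bigr => i _.
have /roots_onP rp := roots_on_rootsR p0.
have ri : D 0 i \in rootsR p.
  rewrite -[_ \in _]/(mem (rootsR p) _) -rp ?inE // root_prod_XsubC.
  by apply: map_f; exact: mem_index_enum.
rewrite (bigD1_seq _ ri) /=; last by rewrite lt_sorted_uniq // sorted_roots.
rewrite eqxx mul1r big1 ?addr0 // => y /negbTE yi.
by rewrite eq_sym yi mul0r.
Qed.

Lemma gram_diagonalization (R : realType) m n (A : 'M[R]_(m, n)) :
  exists (Q : 'M[R]_n) (D : 'rV[R]_n),
    [/\ Q^T *m Q = 1%:M, Q *m Q^T = 1%:M, A^T *m A = Q *m diag_mx D *m Q^T
      & forall i, 0 <= D 0 i].
Proof.
have [|Q [D [Q1 Q2 E]]] := @symmetric_diagonalization R n (A^T *m A).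
  by rewrite trmx_mul trmxK.
exists Q, D; split => // i.
have F : (A *m Q)^T *m (A *m Q) = diag_mx D.
  by rewrite trmx_mul mulmxA -(mulmxA Q^T) E !mulmxA Q1 mul1mx -mulmxA Q1 mulmx1.
have /matrixP/(_ i i) := F; rewrite [diag_mx _ _ _]mxE eqxx mulr1n => <-.
by rewrite mxE; apply: sumr_ge0 => k _; rewrite mxE -expr2 sqr_ge0.
Qed.

Lemma mxrank_diag_le (F : fieldType) n (d : 'rV[F]_n) :
  (\rank (diag_mx d) <= #|[set i | d 0%R i != 0%R]|)%N.
Proof.
have -> : diag_mx d = \sum_(i in [set i | d 0 i != 0]) d 0 i *: delta_mx i i.
  rewrite diag_mx_sum_delta (bigID (mem [set i | d 0 i != 0])) /= addrC big1 ?add0r //.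
  by move=> i; rewrite inE negbK => /eqP ->; rewrite scale0r.
rewrite -sum1_card.
elim/big_rec2: _ => [|i r A iS IH]; first by rewrite mxrank0.
apply: leq_trans (mxrank_add _ _) _; rewrite leq_add //.
by move: iS; rewrite inE => di; rewrite (eqmx_scale _ di) mxrank_delta.
Qed.

(** A right multiple of [diag_mx d] is the projection on the support of [d],
    and the rank of the complementary projection is at most the number of
    zeros of [d]. *)
Lemma mxrank_diag_ge (F : fieldType) n (d : 'rV[F]_n) :
  (#|[set i | d 0%R i != 0%R]| <= \rank (diag_mx d))%N.
Proof.
pose z : 'rV[F]_n := \row_i (d 0 i != 0)%:R.
pose z' : 'rV[F]_n := \row_i (d 0 i == 0)%:R.
have Zd : diag_mx z = diag_mx d *m diag_mx (\row_i (d 0 i)^-1).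
  rewrite mulmx_diag; congr diag_mx; apply/rowP => i; rewrite !mxE.
  by have [->|nz] := eqVneq (d 0 i) 0; rewrite ?mul0r // divff.
have ZZ : 1%:M = diag_mx z + diag_mx z'.
  apply/matrixP => i j; rewrite !mxE -mulrnDl; congr (_ *+ _).
  by case: eqVneq; rewrite ?addr0 ?add0r.
have := mxrank_add (diag_mx z) (diag_mx z'); rewrite -ZZ mxrank1.
have := mxrank_diag_le z'.
have -> : [set i | z' 0 i != 0] = ~: [set i | d 0 i != 0].
  by apply/setP => i; rewrite !inE mxE negbK; case: (d 0 i == 0); rewrite ?oner_eq0 ?eqxx.
have := mxrankM_maxl (diag_mx d) (diag_mx (\row_i (d 0 i)^-1)); rewrite -Zd.
have := cardsC [set i | d 0 i != 0]; rewrite card_ord.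
lia.
Qed.

Lemma frob2_colE (R : realType) m n (B : 'M[R]_(m, n)) i :
  frob2 (col i B) = (B^T *m B) i i.
Proof.
by rewrite frob2_col mxE; apply: eq_bigr => k _; rewrite !mxE expr2.
Qed.

(** The squared Frobenius norm is the sum of the eigenvalues of [A^T *m A]: at
    most [r] of them are nonzero, and each is at most [l ^+ 2]. *)
Lemma frob2_le_rank (R : realType) m n (A : 'M[R]_(m, n)) l r :
  opbound l A -> (\rank A <= r)%N -> frob2 A <= r%:R * l ^+ 2.
Proof.
move=> hA rA; have [Q [D [Q1 Q2 E D0]]] := gram_diagonalization A.
have EQ : Q^T *m (A^T *m A) *m Q = diag_mx D.
  by rewrite E !mulmxA Q1 mul1mx -mulmxA Q1 mulmx1.
have Dl i : D 0 i <= l ^+ 2.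
  have := hA (col i Q); rewrite colE mulmxA -!colE !frob2_colE Q1 trmx_mul.
  by rewrite -(mulmxA Q^T) (mulmxA A^T) mulmxA EQ !mxE eqxx mulr1.
rewrite frob2E E mxtrace_mulC mulmxA Q1 mul1mx mxtrace_diag.
rewrite (bigID (fun i => D 0 i != 0)) /= [X in _ + X]big1 ?addr0; last first.
  by move=> i; rewrite negbK => /eqP.
apply: le_trans (ler_sum _ (fun i _ => Dl i)) _.
rewrite (eq_bigl (fun i => i \in [set i | D 0 i != 0])); last by move=> i; rewrite inE.
rewrite sumr_const -[leLHS]mulr_natl; apply: ler_wpM2r; first exact: sqr_ge0.
rewrite ler_nat (leq_trans _ rA) // (leq_trans _ (mxrankM_maxr A^T A)) //.
have -> : \rank (A^T *m A) = \rank (diag_mx D).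
  apply/eqP; rewrite eqn_leq; apply/andP; split.
    by rewrite E (leq_trans (mxrankM_maxl _ _)) // mxrankM_maxr.
  by rewrite -EQ (leq_trans (mxrankM_maxl _ _)) // mxrankM_maxr.
exact: mxrank_diag_ge.
Qed.

(** * Duality and singular value thresholding *)

(** In an eigenbasis of [B^T *m B] the trace is a sum of inner products of
    columns; those of [G] have norm at most [l], and the norms of those of
    [B] are the singular values. *)
Lemma trace_mul_le_nuclear (R : realType) m n (G B : 'M[R]_(m, n)) l :
  0 <= l -> opbound l G -> \tr (G^T *m B) <= l * nuclear_norm B.
Proof.
move=> l0 hG; have [Q [D [Q1 Q2 E D0]]] := gram_diagonalization B.
rewrite (nuclear_normE Q1 E) mulr_sumr.
have -> : G^T *m B = Q *m ((G *m Q)^T *m (B *m Q)) *m Q^T.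
  by rewrite trmx_mul !mulmxA Q2 mul1mx -!mulmxA Q2 mulmx1.
rewrite mxtrace_mulC (mulmxA Q^T) Q1 mul1mx; apply: ler_sum => i _.
have colG : frob2 (col i (G *m Q)) <= l ^+ 2.
  have := hG (col i Q); rewrite [col i Q]colE mulmxA -!colE [frob2 (col i Q)]frob2_colE.
  by rewrite Q1 mxE eqxx mulr1.
have colB : frob2 (col i (B *m Q)) = D 0 i.
  rewrite frob2_colE trmx_mul -mulmxA (mulmxA B^T) E !mulmxA Q1 mul1mx -mulmxA Q1.
  by rewrite mulmx1 mxE eqxx.
rewrite (le_trans (ler_norm _)) // -[X in _ <= X * _](ger0_norm l0) -sqrtr_sqr -sqrtr_sqr.
rewrite -sqrtrM ?sqr_ge0 // ler_wsqrtr // -colB mxE.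
under eq_bigr do rewrite [(G *m Q)^T _ _]mxE.
apply: le_trans (sqr_sum_mul_le _ _) _.
apply: ler_pM; rewrite ?frob2_col //; try by apply: sumr_ge0 => k _; exact: sqr_ge0.
  by move: colG; rewrite frob2_col; under eq_bigr do rewrite [col _ _ _ _]mxE.
by rewrite le_eqVlt; apply/orP; left; apply/eqP/eq_bigr => k _; rewrite [col _ _ _ _]mxE.
Qed.

Section SingularValueThresholding.
Context {R : realType} {d1 d2 : nat} (M : 'M[R]_(d1, d2)) (l : R).
Context (Q : 'M[R]_d2) (D : 'rV[R]_d2).
Hypotheses (Q1 : Q^T *m Q = 1%:M) (Q2 : Q *m Q^T = 1%:M).
Hypotheses (E : M^T *m M = Q *m diag_mx D *m Q^T) (D0 : forall i, 0 <= D 0 i).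
Hypothesis l0 : 0 <= l.

Let s i := Num.sqrt (D 0 i).

(** The factor that moves a singular value [s i] to [max (s i - l) 0]. *)
Definition shrink : 'rV[R]_d2 := \row_i (if l < s i then 1 - l / s i else 0).

Definition svt : 'M[R]_(d1, d2) := M *m Q *m diag_mx shrink *m Q^T.

Lemma frob2_spectral h p (B : 'M[R]_(d2, p)) :
  frob2 (M *m Q *m diag_mx h *m B) = \sum_i h 0 i ^+ 2 * D 0 i * \sum_j B i j ^+ 2.
Proof.
have F : (M *m Q)^T *m (M *m Q) = diag_mx D.
  by rewrite trmx_mul mulmxA -(mulmxA Q^T) E !mulmxA Q1 mul1mx -mulmxA Q1 mulmx1.
move: (M *m Q) F => N F.
rewrite frob2E 2!trmx_mul tr_diag_mx -!mulmxA (mulmxA N^T) F.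
rewrite mxtrace_mulC -!mulmxA; apply: eq_bigr => i _.
rewrite !mul_diag_mx !mxE expr2 -!mulrA; congr (_ * _).
rewrite mulrCA; congr (_ * _); rewrite [in RHS]mulrC mulr_suml mulr_sumr.
by apply: eq_bigr => j _; rewrite !mxE expr2; ring.
Qed.

Lemma svt_residual : M - svt = M *m Q *m diag_mx (\row_i (1 - shrink 0 i)) *m Q^T.
Proof.
have -> : diag_mx (\row_i (1 - shrink 0 i)) = 1%:M - diag_mx shrink.
  by apply/matrixP => i j; rewrite !mxE -mulrnBl.
by rewrite mulmxBr mulmx1 mulmxBl -(mulmxA M) Q2 mulmx1.
Qed.

Lemma shrink_le i : (1 - shrink 0 i) ^+ 2 * D 0 i <= l ^+ 2.
Proof.
rewrite mxE -(sqr_sqrtr (D0 i)) -/(s i) -exprMn; have s0 : 0 <= s i := sqrtr_ge0 _.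
case: ltP => h.
  have sn : s i != 0 by rewrite gt_eqF // (le_lt_trans l0).
  by rewrite opprB addrC subrK divfK.
by rewrite subr0 mul1r lerXn2r.
Qed.

Lemma shrink_eq i : (1 - shrink 0 i) * shrink 0 i * D 0 i = l * (shrink 0 i * s i).
Proof.
rewrite mxE -(sqr_sqrtr (D0 i)) -/(s i).
case: ltP => h; last by rewrite mulr0 mul0r mul0r mulr0.
have sn : s i != 0 by rewrite gt_eqF // (le_lt_trans l0).
by field.
Qed.

Lemma shrink_ge0 i : 0 <= shrink 0 i.
Proof.
rewrite mxE; case: ltP => // h; have s1 : 0 < s i by rewrite (le_lt_trans l0).
by rewrite subr_ge0 ler_pdivrMr // mul1r ltW.
Qed.

Lemma svt_residual_opbound : opbound l (M - svt).
Proof.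
move=> x; rewrite svt_residual -[_ *m Q^T *m x]mulmxA frob2_spectral.
have -> : frob2 x = frob2 (Q^T *m x).
  by rewrite !frob2E trmx_mul trmxK mulmxA -(mulmxA _ Q) Q2 mulmx1.
rewrite /frob2 mulr_sumr; apply: ler_sum => i _; apply: ler_wpM2r.
  by apply: sumr_ge0 => j _; exact: sqr_ge0.
by rewrite [(\row__ _) _ _]mxE shrink_le.
Qed.

Lemma nuclear_norm_svt : nuclear_norm svt = \sum_i shrink 0 i * s i.
Proof.
rewrite (@nuclear_normE _ _ _ svt Q (\row_i (shrink 0 i ^+ 2 * D 0 i)) Q1).
  apply: eq_bigr => i _; rewrite mxE sqrtrM ?sqr_ge0 // sqrtr_sqr.
  by rewrite ger0_norm ?shrink_ge0.
rewrite /svt !trmx_mul !trmxK tr_diag_mx -!mulmxA; congr (_ *m _).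
rewrite (mulmxA M^T) E !mulmxA -(mulmxA _ Q^T Q) Q1 mulmx1; congr (_ *m _).
rewrite -(mulmxA _ Q^T Q) Q1 mulmx1 !mulmx_diag; congr diag_mx.
by apply/rowP => i; rewrite !mxE; ring.
Qed.

Lemma svt_residual_inner : \tr ((M - svt)^T *m svt) = l * nuclear_norm svt.
Proof.
rewrite nuclear_norm_svt mulr_sumr svt_residual /svt !trmx_mul trmxK tr_diag_mx.
rewrite -!mulmxA (mulmxA M^T) E mxtrace_mulC !mulmxA.
rewrite -(mulmxA _ Q^T Q) Q1 mulmx1 -(mulmxA _ Q^T Q) Q1 mulmx1.
rewrite -(mulmxA _ Q^T Q) Q1 mulmx1.
rewrite !mulmx_diag mxtrace_diag; apply: eq_bigr => i _.
rewrite -shrink_eq 3!mxE; rewrite [(\row__ _) _ _]mxE; ring.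
Qed.

(** The residual [M - svt] has operator norm at most [l] and attains equality
    in the duality between the operator and the nuclear norm, so it is half a
    subgradient of the penalty; the excess loss is then at least quadratic. *)
Lemma svt_minimizes B :
  penalized_loss (2 * l) M svt + frob2 (B - svt) <= penalized_loss (2 * l) M B.
Proof.
rewrite /penalized_loss !normF_sqr.
have -> : M - B = (M - svt) + (svt - B) by rewrite addrA subrK.
rewrite (frob2D (M - svt)); have dual := trace_mul_le_nuclear B l0 svt_residual_opbound.
have -> : frob2 (svt - B) = frob2 (B - svt).
  by rewrite -opprB /frob2; apply: eq_bigr => i _; apply: eq_bigr => j _; rewrite mxE sqrrN.
rewrite [_ *m (svt - B)]mulmxBr [\tr (_ - _)]raddfB /= svt_residual_inner; lra.
Qed.

Lemma nuclear_prox_svt : nuclear_prox (2 * l) M = svt.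
Proof.
rewrite /nuclear_prox; case: xgetP => [A _ minA|noA]; last first.
  case: (noA svt) => B /=; apply: le_trans (svt_minimizes B).
  by rewrite lerDl frob2_ge0.
have := le_trans (svt_minimizes A) (minA svt).
rewrite gerDl => le0.
by apply/eqP; rewrite -subr_eq0 -frob2_eq0 eq_le le0 frob2_ge0.
Qed.

(** If more than [K] singular values of [M] exceeded [l], some nonzero
    combination [x] of their right singular vectors would be killed by [M0];
    then [M *m x = (M - M0) *m x] is both longer and not longer than [l] times
    the length of [x]. *)
Lemma rank_svt (M0 : 'M[R]_(d1, d2)) K :
  opbound l (M - M0) -> (\rank M0 <= K)%N -> (\rank svt <= K)%N.
Proof.
move=> hW rM0; pose z : 'rV[R]_d2 := \row_i (l < s i)%R%:R.
have gz : diag_mx shrink = diag_mx z *m diag_mx shrink.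
  rewrite mulmx_diag; congr diag_mx; apply/rowP => i; rewrite !mxE.
  by case: ifP; rewrite ?mul1r ?mul0r.
have : (\rank svt <= \rank (diag_mx z))%N.
  rewrite /svt gz (leq_trans (mxrankM_maxl _ _)) // (leq_trans (mxrankM_maxr _ _)) //.
  exact: mxrankM_maxl.
move=> /leq_trans; apply; rewrite leqNgt; apply/negP => rz.
pose C : 'M[R]_(d2, d1) := diag_mx z *m Q^T *m M0^T.
have rC : (\rank C <= K)%N by rewrite (leq_trans (mxrankM_maxr _ _)) // mxrank_tr.
have kz : kermx C *m diag_mx z != 0.
  apply/eqP => /mulmx0_rank_max; rewrite mxrank_ker.
  have := rank_leq_row C; lia.
have [i yi] : exists i, row i (kermx C) *m diag_mx z != 0.
  apply/existsP; rewrite -negb_forall; apply: contra kz => /forallP h.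
  by apply/eqP/row_matrixP => i; rewrite row_mul row0; apply/eqP.
have yC : row i (kermx C) *m C = 0 by rewrite -row_mul mulmx_ker row0.
set y := row i _ in yi yC.
pose w := (y *m diag_mx z)^T; pose x := Q *m w.
have M0x : M0 *m x = 0.
  by apply: trmx_inj; rewrite trmx0 -yC /C /x trmx_mul (trmx_mul Q) trmxK !mulmxA.
have := hW x; rewrite mulmxBl M0x subr0.
have -> : frob2 x = frob2 w.
  by rewrite !frob2E trmx_mul mulmxA -(mulmxA _ Q^T Q) Q1 mulmx1.
have -> : M *m x = M *m Q *m diag_mx (const_mx 1) *m w.
  by rewrite diag_const_mx mulmx1 mulmxA.
rewrite frob2_spectral leNgt => /negP; apply.
rewrite /frob2 mulr_sumr.
have w0 : w != 0 by rewrite trmx_eq0.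
have wz k : w k 0 = y 0 k * (l < s k)%R%:R by rewrite mxE mul_mx_diag !mxE.
have [k wk] : exists k, w k 0 != 0.
  apply/existsP; rewrite -negb_forall; apply: contra w0 => /forallP h.
  by apply/eqP/matrixP => k j; rewrite ord1 [RHS]mxE; exact/eqP.
have lt_k j : w j 0 != 0 -> l ^+ 2 < D 0 j.
  rewrite wz; case: ltP => h; last by rewrite mulr0 eqxx.
  by rewrite -(sqr_sqrtr (D0 j)) ltrXn2r // ?nnegrE // ltW // (le_lt_trans l0 h).
rewrite (bigD1 k) //= [ltRHS](bigD1 k) //= ltr_leD //.
  rewrite !big_ord1 [const_mx _ _ _]mxE expr1n mul1r ltr_pM2r ?lt_k //.
  by rewrite lt0r sqrf_eq0 wk sqr_ge0.
apply: ler_sum => j _; rewrite !big_ord1 [const_mx _ _ _]mxE expr1n mul1r.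
have [->|wj] := eqVneq (w j 0) 0; first by rewrite expr0n !mulr0.
by rewrite ler_wpM2r ?sqr_ge0 // ltW // lt_k.
Qed.

Lemma svt_row_eq0 i : row i M = 0 -> row i svt = 0.
Proof. by move=> h; rewrite /svt -!mulmxA row_mul h mul0mx. Qed.

(** Column [j] of [svt] only involves right singular vectors with a nonzero
    singular value, which lie in the row space of [M]. *)
Lemma svt_col_eq0 j : col j M = 0 -> col j svt = 0.
Proof.
move=> h; pose r : 'rV[R]_d2 := \row_i (shrink 0 i / D 0 i).
have -> : svt = M *m Q *m diag_mx r *m Q^T *m M^T *m M.
  rewrite -[RHS]mulmxA E !mulmxA -(mulmxA _ Q^T Q) Q1 mulmx1 -(mulmxA _ (diag_mx r)).
  rewrite mulmx_diag /svt; congr (_ *m diag_mx _ *m _).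
  apply/rowP => i; rewrite !mxE.
  case: ifP => [li|_]; last by rewrite !mul0r.
  rewrite divfK // gt_eqF //.
  have : 0 < s i := le_lt_trans l0 li.
  by rewrite /s sqrtr_gt0.
by rewrite colE -mulmxA -colE h mulmx0.
Qed.

End SingularValueThresholding.

(** Both the estimate and [M0] have rank at most [K] and lie within [l] of [M]
    in operator norm, so their difference has rank at most [2 * K] and operator
    norm at most [2 * l]. *)
Lemma nuclear_prox_error (R : realType) d1 d2 (M M0 : 'M[R]_(d1, d2)) l K :
  0 <= l -> opbound l (M - M0) -> (\rank M0 <= K)%N ->
  frob2 (nuclear_prox (2 * l) M - M0) <= (2 * K)%:R * (2 * l) ^+ 2.
Proof.
move=> l0 hW rM0; have [Q [D [Q1 Q2 E D0]]] := gram_diagonalization M.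
rewrite (nuclear_prox_svt Q1 Q2 E D0 l0).
apply: frob2_le_rank; last first.
  rewrite (leq_trans (mxrank_add _ _)) // mulSn mul1n leq_add //.
    exact: rank_svt hW rM0.
  by rewrite mxrank_opp.
have -> : svt M l Q D - M0 = - (M - svt M l Q D) + (M - M0).
  by rewrite opprB addrA subrK.
rewrite mulr_natl mulr2n; apply: opboundD => // x.
have := svt_residual_opbound Q1 Q2 E D0 l0 x; congr (_ <= _).
by rewrite mulNmx /frob2; apply: eq_bigr => i _; apply: eq_bigr => j _; rewrite [in RHS]mxE sqrrN.
Qed.

Lemma nuclear_prox_support (R : realType) d1 d2 (M : 'M[R]_(d1, d2)) l
    (I : {set 'I_d1}) (J : {set 'I_d2}) :
  0 <= l ->
  (forall i j, ~~ ((i \in I) && (j \in J)) -> M i j = 0) ->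
  forall i j, ~~ ((i \in I) && (j \in J)) -> nuclear_prox (2 * l) M i j = 0.
Proof.
move=> l0 hM i j; have [Q [D [Q1 Q2 E D0]]] := gram_diagonalization M.
rewrite (nuclear_prox_svt Q1 Q2 E D0 l0) negb_and => /orP[iI|jJ].
  have : row i M = 0 by apply/rowP => k; rewrite !mxE hM // (negbTE iI).
  by move=> /(svt_row_eq0 l Q D)/rowP/(_ j); rewrite !mxE.
have : col j M = 0.
  by apply/matrixP => k a; rewrite !mxE hM // (negbTE jJ) andbF.
by move=> /(svt_col_eq0 Q1 E l0)/matrixP/(_ i 0); rewrite !mxE.
Qed.

(** * Traces of powers of symmetric matrices *)

Lemma expr_diagonalized (R : realType) n (Q : 'M[R]_n) (D : 'rV[R]_n) a :
  Q^T *m Q = 1%:M -> Q *m Q^T = 1%:M ->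
  (Q *m diag_mx D *m Q^T) ^+ a = Q *m diag_mx (\row_i (D 0 i ^+ a)) *m Q^T.
Proof.
move=> Q1 Q2; elim: a => [|a IH].
  have -> : \row_i (D 0 i ^+ 0) = const_mx 1 :> 'rV_n by apply/rowP => i; rewrite !mxE.
  by rewrite diag_const_mx mulmx1 Q2.
rewrite exprS IH -[_ * _]/(_ *m _) !mulmxA -(mulmxA _ Q^T Q) Q1 mulmx1.
rewrite -(mulmxA Q) mulmx_diag; congr (_ *m diag_mx _ *m _).
by apply/rowP => i; rewrite !mxE exprS.
Qed.

(** The weights [((QA^T *m QB) i j) ^+ 2] form a joint spectral measure of the
    pair: mixed traces of powers reduce to scalar computations. *)
Lemma trace_mixed_powers (R : realType) n (QA QB : 'M[R]_n) (DA DB : 'rV[R]_n) a b :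
  QA^T *m QA = 1%:M -> QA *m QA^T = 1%:M ->
  QB^T *m QB = 1%:M -> QB *m QB^T = 1%:M ->
  \tr ((QA *m diag_mx DA *m QA^T) ^+ a *m (QB *m diag_mx DB *m QB^T) ^+ b) =
  \sum_i \sum_j (QA^T *m QB) i j ^+ 2 * (DA 0 i ^+ a * DB 0 j ^+ b).
Proof.
move=> A1 A2 B1 B2; rewrite !expr_diagonalized //.
rewrite -!mulmxA mxtrace_mulC -!mulmxA.
have -> : QB^T *m QA = (QA^T *m QB)^T by rewrite trmx_mul trmxK.
rewrite (mulmxA QA^T); move: (QA^T *m QB) => O.
rewrite /mxtrace; apply: eq_bigr => i _.
rewrite mul_diag_mx [LHS]mxE [(_ *m _) i i]mxE [X in X * _]mxE mulr_sumr.
by apply: eq_bigr => j _; rewrite mul_diag_mx !mxE; ring.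
Qed.

(** For nonnegative [X] and [Y], the difference of the two sides factors as
    [(X ^+ a - Y ^+ a) * (X ^+ b - Y ^+ b)]; parity reduces to this case. *)
Lemma mixed_powers_le (R : realFieldType) (x y : R) a b :
  ~~ odd (a + b) -> x ^+ a * y ^+ b + x ^+ b * y ^+ a <= x ^+ (a + b) + y ^+ (a + b).
Proof.
move=> ev; have abs (z : R) : z ^+ (a + b) = `|z| ^+ (a + b).
  by rewrite -normrX ger0_norm // exprn_even_ge0.
rewrite (abs x) (abs y); apply: (@le_trans _ _ (`|x| ^+ a * `|y| ^+ b + `|x| ^+ b * `|y| ^+ a)).
  by rewrite -!normrX -!normrM lerD // ler_norm.
have X0 := normr_ge0 x; have Y0 := normr_ge0 y.
move: `|x| `|y| X0 Y0 => X Y X0 Y0; rewrite -subr_ge0.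
have -> : X ^+ (a + b) + Y ^+ (a + b) - (X ^+ a * Y ^+ b + X ^+ b * Y ^+ a) =
  (X ^+ a - Y ^+ a) * (X ^+ b - Y ^+ b) by rewrite !exprD; ring.
case: (leP X Y) => [|/ltW] h.
  by rewrite mulr_le0 // subr_le0 lerXn2r.
by rewrite mulr_ge0 // subr_ge0 lerXn2r.
Qed.

(** The derivative of an odd power is convex, so the difference quotient is at
    most the average of the derivatives at the two end points. *)
Lemma odd_power_increment (R : realFieldType) (x y : R) r :
  (x - y) * (x ^+ (r.*2).+1 - y ^+ (r.*2).+1) <=
  (r.*2).+1%:R / 2 * ((x - y) ^+ 2 * (x ^+ r.*2 + y ^+ r.*2)).
Proof.
rewrite subrXX mulrA -expr2 mulrCA; apply: ler_wpM2l; first exact: sqr_ge0.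
rewrite mulrAC ler_pdivlMr // mulr_natr mulr2n.
rewrite [X in X + _](reindex_inj rev_ord_inj) -big_split /=.
rewrite -[X in X%:R * _]card_ord -sum1_card natr_sum mulr_suml; apply: ler_sum => i _.
have hi : (i <= r.*2)%N by rewrite -ltnS.
rewrite mul1r subSS subKn // -[in leRHS](subnKC hi).
by apply: mixed_powers_le; rewrite subnKC // odd_double.
Qed.

Lemma trace_sqr_mul_ge0 (R : realType) n (C W : 'M[R]_n) r :
  C^T = C -> W^T = W -> 0 <= \tr ((C *m C) *m W ^+ r.*2).
Proof.
move=> CT WT.
have WrT : (W ^+ r)^T = W ^+ r.
  elim: r => [|r IH]; first exact: trmx1.
  by rewrite {1}exprS -[_ * _]/(_ *m _) trmx_mul IH WT -[_ *m _]/(_ * _) -exprSr.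
rewrite -addnn exprD -[_ * _]/(_ *m _) -mulmxA mxtrace_mulC -!mulmxA (mulmxA (W ^+ r)).
have -> : C *m (W ^+ r *m W ^+ r *m C) = (W ^+ r *m C)^T *m (W ^+ r *m C).
  by rewrite trmx_mul CT WrT !mulmxA.
by rewrite -frob2E frob2_ge0.
Qed.

(** Both sides are integrals against the joint spectral measure of [A] and
    [B], so the scalar inequality applies under the sum. *)
Lemma trace_odd_power_increment (R : realType) n (A B : 'M[R]_n) r :
  A^T = A -> B^T = B ->
  \tr ((A - B) *m (A ^+ (r.*2).+1 - B ^+ (r.*2).+1)) <=
  (r.*2).+1%:R / 2 *
    \tr (((A - B) *m (A - B)) *m (A ^+ r.*2 + B ^+ r.*2)).
Proof.
move=> AT BT.
have [QA [DA [A1 A2 AE]]] := symmetric_diagonalization AT.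
have [QB [DB [B1 B2 BE]]] := symmetric_diagonalization BT.
pose t a b := \tr (A ^+ a *m B ^+ b).
have tE a b : t a b =
    \sum_i \sum_j (QA^T *m QB) i j ^+ 2 * (DA 0 i ^+ a * DB 0 j ^+ b).
  by rewrite /t AE BE trace_mixed_powers.
have e0 (X : 'M[R]_n) : X ^+ 0 = 1%:M by [].
have pw (X : 'M[R]_n) k : X *m X ^+ k = X ^+ k.+1 by rewrite exprS.
have pwr (X : 'M[R]_n) k : X ^+ k *m X = X ^+ k.+1 by rewrite exprSr.
have tl a b : \tr (B ^+ b *m A ^+ a) = t a b by rewrite mxtrace_mulC.
have -> : \tr ((A - B) *m (A ^+ (r.*2).+1 - B ^+ (r.*2).+1)) =
    t (r.*2).+2 0 - t 1 (r.*2).+1 - (t (r.*2).+1 1 - t 0 (r.*2).+2).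
  rewrite mulmxBl !mulmxBr !raddfB /= -tl -[in t (r.*2).+1 1]tl /t.
  by rewrite !e0 !expr1 !pw !mul1mx.
have -> : \tr (((A - B) *m (A - B)) *m (A ^+ r.*2 + B ^+ r.*2)) =
    t (r.*2).+2 0 - 2 * t (r.*2).+1 1 + t r.*2 2
    + (t 2 r.*2 - 2 * t 1 (r.*2).+1 + t 0 (r.*2).+2).
  rewrite mulmxDr !(mulmxBl, mulmxBr) !(raddfD, raddfN) /=.
  have -> : \tr (A *m A *m A ^+ r.*2) = t (r.*2).+2 0.
    by rewrite -mulmxA !pw /t e0 mulmx1.
  have -> : \tr (A *m B *m A ^+ r.*2) = t (r.*2).+1 1.
    by rewrite mxtrace_mulC mulmxA pwr /t expr1.
  have -> : \tr (B *m A *m A ^+ r.*2) = t (r.*2).+1 1.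
    by rewrite -mulmxA mxtrace_mulC pw /t expr1.
  have -> : \tr (B *m B *m A ^+ r.*2) = t r.*2 2.
    by rewrite mxtrace_mulC /t expr2.
  have -> : \tr (A *m A *m B ^+ r.*2) = t 2 r.*2 by rewrite /t expr2.
  have -> : \tr (A *m B *m B ^+ r.*2) = t 1 (r.*2).+1.
    by rewrite -mulmxA pw /t expr1.
  have -> : \tr (B *m A *m B ^+ r.*2) = t 1 (r.*2).+1.
    by rewrite -mulmxA mxtrace_mulC -mulmxA pwr /t expr1.
  have -> : \tr (B *m B *m B ^+ r.*2) = t 0 (r.*2).+2.
    by rewrite -mulmxA !pw /t e0 mul1mx.
  by ring.
rewrite !tE !mulr_sumr; do 4!rewrite -?sumrB -?big_split /=; rewrite !mulr_sumr.
apply: ler_sum => i _.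
rewrite !mulr_sumr; do 4!rewrite -?sumrB -?big_split /=; rewrite !mulr_sumr.
apply: ler_sum => j _.
have := odd_power_increment (DA 0 i) (DB 0 j) r.
have := sqr_ge0 ((QA^T *m QB) i j); rewrite !exprS !expr0.
move: (_ ^+ r.*2) (_ ^+ r.*2) => x y.
set o := (_ *m _) i j * _ => o0 /(ler_wpM2l o0); congr (_ <= _); ring.
Qed.

(** * Expectations over finite product samples *)

Section ProductExpectation.
Context {R : realType} {I T : finType} (q : T -> R).
Hypotheses (q0 : forall y, 0 <= q y) (q1 : \sum_y q y = 1).

Definition weight (x : {ffun I -> T}) : R := \prod_k q (x k).

Definition expect (f : {ffun I -> T} -> R) : R := \sum_x weight x * f x.

Definition resample (x : {ffun I -> T}) (k : I) (y : T) : {ffun I -> T} :=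
  [ffun i => if i == k then y else x i].

Lemma weight_ge0 x : 0 <= weight x.
Proof. exact: prodr_ge0. Qed.

Lemma expect_le f g : (forall x, f x <= g x) -> expect f <= expect g.
Proof. by move=> h; apply: ler_sum => x _; rewrite ler_wpM2l ?weight_ge0. Qed.

Lemma eq_expect f g : f =1 g -> expect f = expect g.
Proof. by move=> h; apply: eq_bigr => x _; rewrite h. Qed.

Lemma expect_prod (F : I -> T -> R) :
  expect (fun x => \prod_k F k (x k)) = \prod_k \sum_y q y * F k y.
Proof. by rewrite bigA_distr_bigA; apply: eq_bigr => x _; rewrite -big_split. Qed.

Lemma expect_cst c : expect (fun=> c) = c.
Proof.
rewrite /expect -mulr_suml.
have := expect_prod (fun _ _ => 1); rewrite [X in _ = X]big1; last first.
  by move=> k _; under eq_bigr do rewrite mulr1.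
rewrite /expect (eq_bigr weight); last by move=> x _; rewrite big1 // mulr1.
by move=> ->; rewrite mul1r.
Qed.

Lemma expectD f g : expect (fun x => f x + g x) = expect f + expect g.
Proof. by rewrite -big_split; apply: eq_bigr => x _; rewrite mulrDr. Qed.

Lemma expectZ c f : expect (fun x => c * f x) = c * expect f.
Proof. by rewrite mulr_sumr; apply: eq_bigr => x _; rewrite mulrCA. Qed.

Lemma expect_sum (J : finType) (P : pred J) (f : J -> {ffun I -> T} -> R) :
  expect (fun x => \sum_(j | P j) f j x) = \sum_(j | P j) expect (f j).
Proof. by rewrite exchange_big; apply: eq_bigr => x _; rewrite mulr_sumr. Qed.

Lemma resampleK x k y : resample (resample x k y) k (x k) = x.
Proof. by apply/ffunP => i; rewrite !ffunE; case: eqP => [->|]. Qed.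

Lemma resample_same x k y : resample x k y k = y.
Proof. by rewrite ffunE eqxx. Qed.

(** The sample [x] and the sample with entry [k] redrawn are exchangeable. *)
Lemma expect_resample k (F : {ffun I -> T} -> T -> R) :
  expect (fun x => \sum_y q y * F x y) =
  expect (fun x => \sum_y q y * F (resample x k y) (x k)).
Proof.
have wE x y : weight (resample x k y) * q (x k) = weight x * q y.
  rewrite /weight (bigD1 k) //= [in RHS](bigD1 k) //= resample_same.
  rewrite (eq_bigr (fun i => q (x i))); last by move=> i /negbTE ik; rewrite ffunE ik.
  by rewrite mulrAC [q y * _]mulrC -!mulrA [_ * q y]mulrC.
rewrite /expect; under eq_bigr do rewrite mulr_sumr.
under [in RHS]eq_bigr do rewrite mulr_sumr.
rewrite !pair_bigA /=.
rewrite (reindex_inj (h := fun p => (resample p.1 k p.2, p.1 k))) /=; last first.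
  apply: (can_inj (g := fun p => (resample p.1 k p.2, p.1 k))) => -[x y] /=.
  by rewrite resampleK resample_same.
by apply: eq_bigr => -[x y] _ /=; rewrite !mulrA wE.
Qed.

End ProductExpectation.

(** * A moment inequality for sums of independent matrices *)

Section MatrixMoment.
Context {R : realType} {I T : finType} (q : T -> R) (n : nat).
Hypotheses (q0 : forall y, 0 <= q y) (q1 : \sum_y q y = 1).
Context (S : T -> 'M[R]_n) (v : T -> 'rV[R]_n).
Hypotheses (ST : forall y, (S y)^T = S y) (SS : forall y, S y *m S y = diag_mx (v y)).
Hypothesis v0 : forall y i, 0 <= v y 0 i.

Local Notation "'\E' f" := (expect (I := I) q f) (at level 10).

Definition centered_sum (x : {ffun I -> T}) : 'M[R]_n :=
  \sum_k (S (x k) - \sum_y q y *: S y).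

(** The sum over [k] of [S (x k) ^+ 2] plus its expectation: the squares of the
    [S y] are diagonal, so only their diagonals are recorded. *)
Definition variance_proxy (x : {ffun I -> T}) : 'rV[R]_n :=
  \sum_k v (x k) + #|I|%:R *: \sum_y q y *: v y.

Lemma centered_sum_sym x : (centered_sum x)^T = centered_sum x.
Proof.
rewrite /centered_sum raddf_sum; apply: eq_bigr => k _ /=.
rewrite raddfB /= ST raddf_sum /=; congr (_ - _).
by apply: eq_bigr => y _; apply/matrixP => i j; rewrite mxE mxE -[in LHS]ST !mxE.
Qed.

Lemma centered_sum_resample x k y :
  centered_sum x - centered_sum (resample x k y) = S (x k) - S y.
Proof.
rewrite /centered_sum (bigD1 k) //= [X in _ - X](bigD1 k) //= resample_same.
rewrite [X in _ - (_ + X)](eq_bigr (fun i => S (x i) - \sum_y q y *: S y)).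
  have cancel (a b c m : 'M[R]_n) : a - m + b - (c - m + b) = a - c.
    by rewrite opprD addrACA subrr addr0 opprB addrA subrK.
  exact: cancel.
by move=> i /negbTE ik; rewrite ffunE ik.
Qed.

(** [(A - B) ^+ 2 + (A + B) ^+ 2] is twice the sum of the squares. *)
Lemma trace_increment_sqr_le (A B W : 'M[R]_n) r :
  A^T = A -> B^T = B -> W^T = W ->
  \tr (((A - B) *m (A - B)) *m W ^+ r.*2) <=
  2 * \tr ((A *m A + B *m B) *m W ^+ r.*2).
Proof.
move=> AT BT WT; have CT : (A + B)^T = A + B by rewrite raddfD /= AT BT.
rewrite -subr_ge0; apply: le_trans (trace_sqr_mul_ge0 r CT WT) _.
rewrite le_eqVlt; apply/orP; left; apply/eqP.
have -> : (A + B) *m (A + B) = 2 *: (A *m A + B *m B) - (A - B) *m (A - B).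
  rewrite !(mulmxBl, mulmxBr, mulmxDl, mulmxDr).
  move: (A *m A) (A *m B) (B *m A) (B *m B) => a b c d.
  by apply/matrixP => i j; rewrite !mxE; ring.
by rewrite mulmxBl raddfB /= -scalemxAl linearZ.
Qed.

Lemma young_power (p : nat) (a b : R) : 0 <= a -> 0 <= b ->
  p.+1%:R * (a * b ^+ p) <= a ^+ p.+1 + p%:R * b ^+ p.+1.
Proof.
move=> a0 b0; elim: p => [|p IH]; first by rewrite mul1r mulr1 mul0r addr0.
have h : 0 <= (a - b) * (a ^+ p.+1 - b ^+ p.+1).
  case: (leP a b) => [|/ltW] ab.
    by rewrite mulr_le0 // subr_le0 ?lerXn2r.
  by rewrite mulr_ge0 // subr_ge0 ?lerXn2r.
have := ler_wpM2r b0 IH; have {h} := h.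
rewrite -[p.+2%:R]natr1 -[p.+1%:R]natr1 (exprS a p.+1) (exprS b p.+1) (exprS b p).
move: (a ^+ p.+1) (b ^+ p) => x y; lra.
Qed.

(** Write [Y_k] for the [k]-th centered summand and [W] for the sum. Since the
    redrawn summand is centered and independent of [W], exchangeability turns
    [tr (Y_k W^(2r+1))] into half the trace of a product of two increments. The
    trace inequality for odd powers bounds it by a quadratic variation, whose
    expectation over the redrawn entry is diagonal. *)
Lemma expect_trace_step r :
  \E (fun x => \tr (centered_sum x ^+ (r.*2).+2)) <=
  (r.*2).+1%:R *
    \E (fun x => \tr (diag_mx (variance_proxy x) *m centered_sum x ^+ r.*2)).
Proof.
pose W := centered_sum; pose m := \sum_y q y *: S y.
pose p := (r.*2).+1.
have split_ x : \tr (W x ^+ p.+1) = \sum_k \tr ((S (x k) - m) *m W x ^+ p).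
  by rewrite exprS -[_ * _]/(_ *m _) {1}/W /centered_sum mulmx_suml raddf_sum.
have first_ k : \E (fun x => \tr ((S (x k) - m) *m W x ^+ p)) =
    \E (fun x => \sum_y q y * \tr ((S (x k) - S y) *m W x ^+ p)).
  apply: eq_expect => x.
  have -> : S (x k) - m = \sum_y q y *: (S (x k) - S y).
    under eq_bigr do rewrite scalerBr.
    by rewrite sumrB -scaler_suml q1 scale1r.
  rewrite mulmx_suml raddf_sum; apply: eq_bigr => y _.
  by rewrite -scalemxAl /= linearZ.
have swap_ k : \E (fun x => \tr ((S (x k) - m) *m W x ^+ p)) =
    \E (fun x => \sum_y q y * (2^-1 *
      \tr ((S (x k) - S y) *m (W x ^+ p - W (resample x k y) ^+ p)))).
  have h := first_ k; have h' := h.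
  rewrite [in RHS](expect_resample q k) in h'.
  have half (z : R) : z = 2^-1 * (z + z) by field.
  rewrite [LHS]half {1}h h'.
  rewrite -expectD -expectZ; apply: eq_expect => x.
  rewrite -big_split mulr_sumr; apply: eq_bigr => y _ /=.
  rewrite resample_same mulmxBr raddfB /= -[S y - _]opprB mulNmx raddfN /=; ring.
have bound_ k : \E (fun x => \tr ((S (x k) - m) *m W x ^+ p)) <=
    p%:R * \E (fun x => \sum_y q y *
      \tr ((S (x k) *m S (x k) + S y *m S y) *m W x ^+ r.*2)).
  pose G (x : {ffun I -> T}) y := p%:R / 2 * 2^-1 *
      \tr (((S (x k) - S y) *m (S (x k) - S y)) *m W x ^+ r.*2).
  apply: (@le_trans _ _ (2 * \E (fun x => \sum_y q y * G x y))).
    have -> : 2 * \E (fun x => \sum_y q y * G x y) = \E (fun x => \sum_y q y * G x y)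
        + \E (fun x => \sum_y q y * G (resample x k y) (x k)).
      by rewrite -(expect_resample q k G); ring.
    rewrite swap_ -expectD.
    apply: expect_le => // x; rewrite -big_split; apply: ler_sum => y _ /=.
    rewrite -mulrDr ler_wpM2l // /G resample_same.
    have := trace_odd_power_increment r (centered_sum_sym x)
      (centered_sum_sym (resample x k y)).
    rewrite centered_sum_resample mulmxDr raddfD /= -/p -/W.
    have -> : (S y - S (x k)) *m (S y - S (x k)) =
        (S (x k) - S y) *m (S (x k) - S y).
      by rewrite -[S y - _]opprB mulNmx mulmxN opprK.
    move=> h; lra.
  rewrite -!expectZ; apply: expect_le => // x.
  rewrite !mulr_sumr; apply: ler_sum => y _.
  rewrite mulrCA [leRHS]mulrCA ler_wpM2l // /G.
  have := trace_increment_sqr_le r (ST (x k)) (ST y) (centered_sum_sym x).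
  rewrite -/(W x) => h; have := ler_wpM2l (ler0n R p) h.
  move: (\tr (_ *m W x ^+ _)) (\tr (_ *m W x ^+ _)) => s t; lra.
rewrite (eq_expect _ split_) expect_sum.
apply: le_trans (ler_sum _ (fun k _ => bound_ k)) _.
rewrite -mulr_sumr ler_wpM2l // -expect_sum le_eqVlt; apply/orP; left; apply/eqP.
apply: eq_expect => x.
have -> : diag_mx (variance_proxy x) = \sum_k \sum_y q y *: (diag_mx (v (x k)) + diag_mx (v y)).
  under eq_bigr do (under eq_bigr do rewrite scalerDr; rewrite big_split /= -scaler_suml q1 scale1r).
  rewrite big_split /= sumr_const -scaler_nat /variance_proxy linearD linearZ /= !linear_sum /=.
  by congr (_ + _); apply: eq_bigr => y _; rewrite [diag_mx (_ *: _)]linearZ.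
rewrite mulmx_suml raddf_sum; apply: eq_bigr => k _ /=.
rewrite mulmx_suml raddf_sum; apply: eq_bigr => y _ /=.
by rewrite !SS -scalemxAl linearZ.
Qed.

Lemma variance_proxy_ge0 x i : 0 <= variance_proxy x 0 i.
Proof.
rewrite !mxE !summxE addr_ge0 ?sumr_ge0 // mulr_ge0 // sumr_ge0 // => y _.
by rewrite mxE mulr_ge0.
Qed.

(** A noncommutative Khintchine-type bound without symmetrization. The variance
    proxy is random and coupled to [W]; Young's inequality, applied under the
    joint spectral measure of the proxy and of [W], separates the two and lets
    the moment of [W] be absorbed in the left-hand side. *)
Theorem expect_trace_power r :
  \E (fun x => \tr (centered_sum x ^+ (r.+1).*2)) <=
  (r.*2).+1%:R ^+ r.+1 * \E (fun x => \sum_i variance_proxy x 0 i ^+ r.+1).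
Proof.
pose W := centered_sum; pose V := variance_proxy; pose c : R := (r.*2).+1%:R.
have young x : r.+1%:R * (c * \tr (diag_mx (V x) *m W x ^+ r.*2)) <=
    c ^+ r.+1 * (\sum_i V x 0 i ^+ r.+1) + r%:R * \tr (W x ^+ (r.+1).*2).
  have [Q [D [Q1 Q2 E]]] := symmetric_diagonalization (centered_sum_sym x).
  have I1 : (1%:M : 'M[R]_n)^T *m 1%:M = 1%:M by rewrite trmx1 mul1mx.
  have I2 : (1%:M : 'M[R]_n) *m 1%:M^T = 1%:M by rewrite trmx1 mul1mx.
  have VE : diag_mx (V x) = 1%:M *m diag_mx (V x) *m 1%:M^T.
    by rewrite trmx1 mulmx1 mul1mx.
  have tE a b : \tr (diag_mx (V x) ^+ a *m W x ^+ b) =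
      \sum_i \sum_j (1%:M^T *m Q) i j ^+ 2 * (V x 0 i ^+ a * D 0 j ^+ b).
    by rewrite {1}VE /W E trace_mixed_powers.
  have := tE 1%N r.*2; rewrite expr1 => ->.
  have -> : \sum_i V x 0 i ^+ r.+1 = \tr (diag_mx (V x) ^+ r.+1 *m W x ^+ 0).
    rewrite expr0 mulmx1 VE expr_diagonalized // mul1mx trmx1 mulmx1 mxtrace_diag.
    by apply: eq_bigr => i _; rewrite [RHS]mxE.
  have -> : \tr (W x ^+ (r.+1).*2) = \tr (diag_mx (V x) ^+ 0 *m W x ^+ (r.+1).*2).
    by rewrite expr0 mul1mx.
  rewrite !tE !mulr_sumr -big_split /=; apply: ler_sum => i _.
  rewrite !mulr_sumr -big_split /=; apply: ler_sum => j _.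
  have o0 := sqr_ge0 ((1%:M^T *m Q) i j).
  have Vc : 0 <= c * V x 0 i by rewrite mulr_ge0 ?variance_proxy_ge0.
  have := ler_wpM2l o0 (young_power r Vc (sqr_ge0 (D 0 j))).
  rewrite [(c * _) ^+ _]exprMn -[_ ^+ 2 ^+ r]exprM -[_ ^+ 2 ^+ r.+1]exprM !mul2n !expr0 !expr1.
  move: (_ ^+ 2) (c ^+ r.+1) (V x 0 i ^+ r.+1) (D 0 j ^+ r.*2) (D 0 j ^+ (r.+1).*2).
  by move=> o a b d e; congr (_ <= _); ring.
have step := expect_trace_step r.
have := @expect_le R I T q q0 _ _ young.
rewrite expectZ expectD !expectZ -/c.
have -> : (r.+1).*2 = (r.*2).+2 by rewrite doubleS.
move: step; rewrite -/c -(ler_pM2l (_ : 0 < r.+1%:R)) ?ltr0n //.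
move=> h1 h2; have := le_trans h1 h2; rewrite -[r.+1%:R]natr1; lra.
Qed.

End MatrixMoment.

(** * Counting hits: binomial moments and lower tail *)

Section Counting.
Context {R : realType} {I T : finType} (q : T -> R).
Hypotheses (q0 : forall y, 0 <= q y) (q1 : \sum_y q y = 1).
Context (P : pred T).

Local Notation "'\E' f" := (expect (I := I) q f) (at level 10).

Definition hits (x : {ffun I -> T}) : R := \sum_k (P (x k))%:R.

Definition hit_prob : R := \sum_y q y * (P y)%:R.

Lemma hits_ge0 x : 0 <= hits x. Proof. exact: sumr_ge0. Qed.

Lemma hit_prob_ge0 : 0 <= hit_prob.
Proof. by apply: sumr_ge0 => y _; rewrite mulr_ge0. Qed.

(** One factor of the power is expanded over the draws. A draw that hits can be
    exchanged with a redrawn entry, which costs at most one hit; this raises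
    the shift [a] by one and lowers the exponent. *)
Lemma expect_hits_moment p (a : R) : 0 <= a ->
  \E (fun x => (hits x + a) ^+ p) <= (#|I|%:R * hit_prob + a + p%:R) ^+ p.
Proof.
elim: p a => [|p IH] a a0; first by under eq_expect do rewrite expr0; rewrite expect_cst.
have m0 : 0 <= #|I|%:R * hit_prob by rewrite mulr_ge0 ?hit_prob_ge0.
have stepk k : \E (fun x => (P (x k))%:R * (hits x + a) ^+ p) <=
    hit_prob * \E (fun x => (hits x + 1 + a) ^+ p).
  have -> : \E (fun x => (P (x k))%:R * (hits x + a) ^+ p) =
      \E (fun x => \sum_y q y * ((P (x k))%:R * (hits x + a) ^+ p)).
    by apply: eq_expect => x; rewrite -mulr_suml q1 mul1r.
  rewrite (expect_resample q k) -expectZ; apply: expect_le => // x.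
  rewrite mulr_suml; apply: ler_sum => y _; rewrite -mulrA ler_wpM2l //.
  rewrite resample_same ler_wpM2l // lerXn2r ?nnegrE ?addr_ge0 ?hits_ge0 //.
  rewrite lerD2r /hits (bigD1 k) //= [in leRHS](bigD1 k) //= resample_same.
  rewrite (eq_bigr (fun i => (P (x i))%:R)).
    rewrite addrAC lerD2r.
    by apply: (@le_trans _ _ 1); rewrite ?lerDr // lern1 leq_b1.
  by move=> i /negbTE ik; rewrite ffunE ik.
have -> : \E (fun x => (hits x + a) ^+ p.+1) =
    \sum_k \E (fun x => (P (x k))%:R * (hits x + a) ^+ p)
    + a * \E (fun x => (hits x + a) ^+ p).
  rewrite -expect_sum -expectZ -expectD; apply: eq_expect => x.
  by rewrite exprS mulrDl {1}/hits mulr_suml.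
have h1 : \E (fun x => (hits x + 1 + a) ^+ p) <=
    (#|I|%:R * hit_prob + a + p.+1%:R) ^+ p.
  under eq_expect do rewrite -addrA; apply: le_trans (IH _ _) _; first by rewrite addr_ge0.
  rewrite le_eqVlt; apply/orP; left; apply/eqP; congr (_ ^+ _).
  by rewrite -[p.+1%:R]natr1; ring.
have h2 : \E (fun x => (hits x + a) ^+ p) <= (#|I|%:R * hit_prob + a + p.+1%:R) ^+ p.
  apply: le_trans (IH _ a0) _.
  by rewrite lerXn2r ?nnegrE ?addr_ge0 // lerD2l ler_nat.
apply: le_trans (lerD (ler_sum _ (fun k _ => stepk k)) (ler_wpM2l a0 h2)) _.
rewrite sumr_const -[_ *+ _]mulr_natl mulrA.
apply: le_trans (lerD (ler_wpM2l m0 h1) (lexx _)) _.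
by rewrite -mulrDl exprS ler_wpM2r ?exprn_ge0 ?addr_ge0 // lerDl.
Qed.

(** The exponential moment at [-1/2]: the bound [expR (-1/2) <= 2/3] leaves
    [1/3 - 1/4 = 1/12] in the exponent. *)
Lemma expect_few_hits :
  \E (fun x => (hits x < #|I|%:R * hit_prob / 2)%R%:R) <=
  expR (- (#|I|%:R * hit_prob / 12)).
Proof.
set m := #|I|%:R * hit_prob; have p0 := hit_prob_ge0.
pose F (y : T) := expR (- ((P y)%:R / 2)) : R.
apply: (@le_trans _ _ (\E (fun x => expR (m / 4) * \prod_k F (x k)))).
  apply: expect_le => // x; rewrite -expR_sum -expRD sumrN -mulr_suml -/(hits x).
  case: ltP => h; last exact: expR_ge0.
  by rewrite -[true%:R]/(1 : R); apply: le_trans (expR_ge1Dx _); lra.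
rewrite expectZ (expect_prod q (fun=> F)) prodr_const.
have Fle : \sum_y q y * F y <= expR (- (hit_prob / 3)).
  apply: (@le_trans _ _ (1 - hit_prob / 3)); last exact: expR_ge1Dx.
  rewrite -{1}q1 /hit_prob mulr_suml -sumrB; apply: ler_sum => y _.
  rewrite -mulrA -[X in _ <= X - _]mulr1 -mulrBr ler_wpM2l // /F.
  case: (P y) => /=; last by rewrite -[0%:R]/(0 : R) !mul0r oppr0 expR0; lra.
  rewrite expRN -[leRHS]invrK lef_pV2 ?posrE ?expR_gt0 ?invr_gt0 //; last by lra.
  apply: le_trans (expR_ge1Dx _).
  by rewrite -[leLHS]mul1r ler_pdivrMr; lra.
apply: (@le_trans _ _ (expR (m / 4) * expR (- (hit_prob / 3)) ^+ #|I|)).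
  rewrite ler_wpM2l ?expR_ge0 // lerXn2r ?nnegrE ?expR_ge0 ?Fle //.
  by apply: sumr_ge0 => y _; rewrite mulr_ge0 ?expR_ge0.
rewrite -expRM_natl -expRD ler_expR /m; lra.
Qed.

End Counting.

(** An even moment of the spectrum dominates the same power of each
    eigenvalue. *)
Lemma opbound_of_trace (R : realType) n (A : 'M[R]_n) (l : R) r :
  A^T = A -> 0 <= l -> \tr (A ^+ (r.+1).*2) <= l ^+ (r.+1).*2 -> opbound l A.
Proof.
move=> AT l0; have [Q [D [Q1 Q2 E]]] := symmetric_diagonalization AT.
rewrite E expr_diagonalized // mxtrace_mulC mulmxA Q1 mul1mx mxtrace_diag => h.
have Dl i : D 0 i ^+ 2 <= l ^+ 2.
  rewrite -(@ler_pXn2r _ r.+1) ?nnegrE ?sqr_ge0 // -!exprM mul2n.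
  apply: le_trans h; rewrite (bigD1 i) //= mxE lerDl.
  by apply: sumr_ge0 => j _; rewrite mxE exprn_even_ge0 // odd_double.
move=> x; rewrite -!mulmxA frob2E trmx_mul mulmxA -(mulmxA _ Q^T Q) Q1 mulmx1 -frob2E.
have -> : frob2 x = frob2 (Q^T *m x).
  by rewrite !frob2E trmx_mul trmxK mulmxA -(mulmxA _ Q) Q2 mulmx1.
rewrite !frob2_col mulr_sumr; apply: ler_sum => i _.
by rewrite mul_diag_mx [in leLHS]mxE exprMn ler_wpM2r ?sqr_ge0.
Qed.

Definition dilation (R : realType) d1 d2 (A : 'M[R]_(d1, d2)) : 'M[R]_(d1 + d2) :=
  block_mx 0 A A^T 0.

Section Dilation.
Context {R : realType} {d1 d2 : nat}.
Implicit Types A B : 'M[R]_(d1, d2).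

Lemma dilation_sym A : (dilation A)^T = dilation A.
Proof. by rewrite /dilation tr_block_mx trmxK !trmx0. Qed.

Lemma dilationB A B : dilation (A - B) = dilation A - dilation B.
Proof. by rewrite /dilation opp_block_mx add_block_mx !oppr0 !addr0 [(_ - _)^T]raddfB. Qed.

Lemma dilationZ c A : dilation (c *: A) = c *: dilation A.
Proof. by rewrite /dilation scale_block_mx !scaler0 [(_ *: _)^T]linearZ. Qed.

Lemma dilation_sum (J : finType) (F : J -> 'M[R]_(d1, d2)) :
  dilation (\sum_k F k) = \sum_k dilation (F k).
Proof.
apply: (big_morph (@dilation R d1 d2)) => [A B|]; last by rewrite /dilation trmx0 block_mx0.
by rewrite /dilation add_block_mx !addr0 [(_ + _)^T]raddfD.
Qed.

Lemma opbound_dilation A l : opbound l (dilation A) -> opbound l A.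
Proof.
move=> h x; have := h (col_mx 0 x); rewrite /dilation.
rewrite mul_block_col !mul0mx !mulmx0 addr0 add0r.
have split_ (u : 'cV[R]_d1) (v : 'cV[R]_d2) : frob2 (col_mx u v) = frob2 u + frob2 v.
  rewrite !frob2_col big_split_ord; congr (_ + _); apply: eq_bigr => i _.
    by rewrite col_mxEu.
  by rewrite col_mxEd.
have z m : frob2 (0 : 'cV[R]_m) = 0 by apply/eqP; rewrite frob2_eq0.
by rewrite !split_ !z addr0 add0r.
Qed.

End Dilation.

(** * Sampling noise of a block *)

Definition block_part (R : realType) d1 d2 (A : {set 'I_d1}) (B : {set 'I_d2})
    (M : 'M[R]_(d1, d2)) : 'M[R]_(d1, d2) :=
  \matrix_(i, j) (if (i \in A) && (j \in B) then M i j else 0).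

Definition freq (R : realType) d1 d2 n (x : {ffun 'I_n -> 'I_d1 * 'I_d2}) : 'M[R]_(d1, d2) :=
  \matrix_(i, j) (#|[set k | x k == (i, j)]|%:R / n%:R).

Section BlockNoise.
Context {R : realType} {d1 d2 n : nat} (P : 'M[R]_(d1, d2)).
Hypotheses (P0 : forall i j, 0 <= P i j) (P1 : \sum_i \sum_j P i j = 1).
Context (A : {set 'I_d1}) (B : {set 'I_d2}).

Local Notation T := ('I_d1 * 'I_d2)%type.
Let q (y : T) : R := P y.1 y.2.

Lemma law_sum1 : \sum_y q y = 1.
Proof. by rewrite -P1 pair_bigA. Qed.

Let inb (y : T) : bool := (y.1 \in A) && (y.2 \in B).

(** The Hermitian dilation of the matrix unit of an observation; it vanishes
    when the observation falls outside the block. *)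
Definition cell_dilation (y : T) : 'M[R]_(d1 + d2) :=
  dilation ((inb y)%:R *: delta_mx y.1 y.2).

(** Rows and columns are indexed jointly, as in the dilation. *)
Definition line_hit (i : 'I_(d1 + d2)) (y : T) : bool :=
  inb y && match fintype.split i with inl a => y.1 == a | inr b => y.2 == b end.

(** Because this square is diagonal, the variance proxy counts the
    observations in each line of the block, which are binomial. *)
Lemma cell_dilation_sqr y :
  cell_dilation y *m cell_dilation y = diag_mx (\row_i (line_hit i y)%:R).
Proof.
have -> : (\row_i (line_hit i y)%:R) =
    row_mx ((inb y)%:R *: delta_mx 0 y.1) ((inb y)%:R *: delta_mx 0 y.2) :> 'rV[R]_(d1 + d2).
  apply/rowP => i; rewrite [LHS]mxE [RHS]mxE /line_hit.
  by case: (fintype.split i) => a; rewrite !mxE eqxx eq_sym -mulnb natrM.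
have diag_delta m (i : 'I_m) : diag_mx (delta_mx 0 i : 'rV[R]_m) = delta_mx i i.
  apply/matrixP => a b; rewrite !mxE eqxx /=.
  by rewrite -mulrnA mulnb; case: (eqVneq a i) => [->|//]; rewrite eq_sym.
rewrite diag_mx_row /cell_dilation /dilation mulmx_block !mulmx0 !mul0mx !addr0 !add0r.
case: (inb y) => /=.
  by rewrite -[1%:R]/(1 : R) !scale1r !diag_delta trmx_delta !mul_delta_mx.
by rewrite -[0%:R]/(0 : R) !scale0r !mul0mx !linear0.
Qed.

Lemma cell_dilation_sym y : (cell_dilation y)^T = cell_dilation y.
Proof. exact: dilation_sym. Qed.

Lemma centered_sum_block (x : {ffun 'I_n -> T}) : (0 < n)%N ->
  centered_sum q cell_dilation x =
  n%:R *: dilation (block_part A B (freq R x) - block_part A B P).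
Proof.
move=> n0; set W := block_part _ _ _ - _.
have WE : n%:R *: W = \sum_k ((inb (x k))%:R *: delta_mx (x k).1 (x k).2
    - \sum_y q y *: ((inb y)%:R *: delta_mx y.1 y.2)).
  apply/matrixP => i j; rewrite !mxE summxE.
  under eq_bigr => k _.
    rewrite !mxE summxE (bigD1 (i, j)) //= big1; last first.
      move=> y yij; rewrite !mxE; case: eqP => [i1|]; rewrite /= ?mulr0 //.
      case: eqP => [j1|]; rewrite /= ?mulr0 //.
      by case/eqP: yij; rewrite [y]surjective_pairing -i1 -j1.
    rewrite !mxE !eqxx addr0 mulr1.
  over.
  rewrite sumrB sumr_const card_ord -[_ * _ *+ n]mulr_natl mulrBr; congr (_ - _); last first.
    by rewrite /inb /q /=; case: ifP; rewrite ?mulr1 ?mulr0.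
  case: ifP => [ijb|ijb]; last first.
    rewrite mulr0 big1 // => k _.
    case: eqP => [i1|]; rewrite /= ?mulr0 //.
    case: eqP => [j1|]; rewrite /= ?mulr0 //.
    by rewrite /inb -i1 -j1 ijb mul0r.
  rewrite mulrC divfK ?pnatr_eq0 -?lt0n // -sum1_card natr_sum big_mkcond /=.
  apply: eq_bigr => k _; rewrite inE -pair_eqE /= [_ == i]eq_sym [_ == j]eq_sym.
  case: eqP => [i1|]; rewrite /= ?mulr0 //.
  case: eqP => [j1|]; rewrite /= ?mulr0 //.
  by rewrite /inb -i1 -j1 ijb mul1r.
rewrite -dilationZ WE dilation_sum /centered_sum; apply: eq_bigr => k _.
rewrite dilationB dilation_sum; congr (_ - _).
by apply: eq_bigr => y _; rewrite dilationZ.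
Qed.

Lemma hit_prob_line_le (mu : R) i : 0 <= mu ->
  (forall a, a \in A -> \sum_b P a b <= mu) ->
  (forall b, b \in B -> \sum_a P a b <= mu) ->
  hit_prob q (line_hit i) <= mu.
Proof.
move=> mu0 hA hB; rewrite /hit_prob /line_hit.
case: (fintype.split i) => c.
  have [cA|cA] := boolP (c \in A); last first.
    rewrite big1 // => y _; rewrite /inb.
    by case: (y.1 =P c) => [->|_]; rewrite ?(negbTE cA) ?andbF mulr0.
  apply: le_trans (hA c cA).
  rewrite -(pair_bigA _ (fun a b => q (a, b) * (inb (a, b) && (a == c))%:R)) /=.
  rewrite (bigD1 c) //= [X in _ + X]big1 ?addr0; last first.
    by move=> a /negbTE ac; rewrite big1 // => b _; rewrite ac andbF mulr0.
  apply: ler_sum => b _; rewrite /q /= -[leRHS]mulr1 ler_wpM2l //.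
  by rewrite lern1 leq_b1.
have [cB|cB] := boolP (c \in B); last first.
  rewrite big1 // => y _; rewrite /inb.
  by case: (y.2 =P c) => [->|_]; rewrite ?(negbTE cB) ?andbF mulr0.
apply: le_trans (hB c cB).
rewrite -(pair_bigA _ (fun a b => q (a, b) * (inb (a, b) && (b == c))%:R)) /= exchange_big /=.
rewrite (bigD1 c) //= [X in _ + X]big1 ?addr0; last first.
  by move=> a /negbTE ac; rewrite big1 // => b _; rewrite ac andbF mulr0.
apply: ler_sum => a _; rewrite /q /= -[leRHS]mulr1 ler_wpM2l //.
by rewrite lern1 leq_b1.
Qed.

(** Markov's inequality for the trace of the power [2 * r.+1] of the dilated
    noise, which is bounded by the moments of the variance proxy; the mean of
    each entry of the proxy is at most [2 * (n%:R * mu)]. *)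
Theorem block_noise_tail (mu l : R) r : (0 < n)%N -> 0 <= mu -> 0 < l ->
  (forall a, a \in A -> \sum_b P a b <= mu) ->
  (forall b, b \in B -> \sum_a P a b <= mu) ->
  expect q (fun x : {ffun 'I_n -> T} =>
    (~~ `[< opbound l (block_part A B (freq R x) - block_part A B P) >])%:R) <=
  (d1 + d2)%:R *
  ((r.*2).+1%:R * (2 * (n%:R * mu) + r.+1%:R) / (n%:R * l) ^+ 2) ^+ r.+1.
Proof.
move=> n0 mu0 l0 hA hB; have q0 y : 0 <= q y by exact: P0.
have q1 := law_sum1; pose v y : 'rV[R]_(d1 + d2) := \row_i (line_hit i y)%:R.
have v0 y i : 0 <= v y 0 i by rewrite mxE.
have nl0 : 0 < n%:R * l by rewrite mulr_gt0 ?ltr0n.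
have := @expect_trace_power R 'I_n T q _ q0 q1 cell_dilation v cell_dilation_sym
  cell_dilation_sqr v0 r.
set W := centered_sum q cell_dilation => mom.
have WT (x : {ffun 'I_n -> T}) : (W x)^T = W x := centered_sum_sym q cell_dilation_sym x.
have even_ge0 (x : {ffun 'I_n -> T}) : 0 <= \tr (W x ^+ (r.+1).*2).
  have := @trace_sqr_mul_ge0 R _ 1%:M (W x) r.+1 (trmx1 _ _) (WT x).
  by rewrite !mul1mx.
apply: (@le_trans _ _ ((n%:R * l) ^- (r.+1).*2 * expect q (fun x => \tr (W x ^+ (r.+1).*2)))).
  rewrite -expectZ; apply: expect_le => // x.
  case: asboolP => h /=; first by rewrite mulr_ge0 // invr_ge0 exprn_ge0 // ltW.
  rewrite -[1%:R]/(1 : R) mulrC ler_pdivlMr ?exprn_gt0 // mul1r leNgt; apply/negP => lt_tr.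
  apply: h; apply: opbound_dilation => y.
  have := opbound_of_trace (WT x) (ltW nl0) (ltW lt_tr) y.
  rewrite /W centered_sum_block // -scalemxAl; set z := _ *m y.
  have -> : frob2 (n%:R *: z) = n%:R ^+ 2 * frob2 z.
    rewrite /frob2 mulr_sumr; apply: eq_bigr => i _; rewrite mulr_sumr.
    by apply: eq_bigr => j _; rewrite mxE exprMn.
  by rewrite [(n%:R * l) ^+ 2]exprMn -[X in _ <= X -> _]mulrA ler_pM2l // exprn_gt0 // ltr0n.
have Vle : expect q (fun x : {ffun 'I_n -> T} => \sum_i variance_proxy q v x 0 i ^+ r.+1) <=
    (d1 + d2)%:R * (2 * (n%:R * mu) + r.+1%:R) ^+ r.+1.
  rewrite expect_sum -[X in X%:R * _]card_ord -sum1_card natr_sum mulr_suml.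
  apply: ler_sum => i _; rewrite mul1r.
  have VE (x : {ffun 'I_n -> T}) : variance_proxy q v x 0 i =
      hits (line_hit i) x + n%:R * hit_prob q (line_hit i).
    rewrite /variance_proxy !mxE !summxE card_ord; congr (_ + _ * _).
      by apply: eq_bigr => k _; rewrite mxE.
    by apply: eq_bigr => y _; rewrite !mxE.
  under eq_expect do rewrite VE.
  have p0 := hit_prob_ge0 q0 (line_hit i).
  have a0 : 0 <= n%:R * hit_prob q (line_hit i) by rewrite mulr_ge0.
  apply: le_trans (@expect_hits_moment R 'I_n T q q0 q1 (line_hit i) r.+1 _ a0) _.
  have hle := hit_prob_line_le i mu0 hA hB.
  rewrite card_ord lerXn2r ?nnegrE ?addr_ge0 ?mulr_ge0 // lerD2r.
  have := ler_wpM2l (ler0n R n) hle; lra.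
rewrite [leRHS](_ : _ = (n%:R * l) ^- (r.+1).*2 * ((r.*2).+1%:R ^+ r.+1 *
    ((d1 + d2)%:R * (2 * (n%:R * mu) + r.+1%:R) ^+ r.+1))).
  rewrite ler_wpM2l ?invr_ge0 ?exprn_ge0 ?(ltW nl0) //.
  by apply: le_trans mom _; rewrite ler_wpM2l ?exprn_ge0.
rewrite 2!exprMn exprVn -exprM mul2n.
move: (_ ^- _) (_ ^+ r.+1) (_ ^+ r.+1) => a b c; ring.
Qed.

End BlockNoise.

(** * The entrywise l1 norm *)

Section Norm1.
Context {R : realType} {d1 d2 : nat}.
Implicit Types M N P : 'M[R]_(d1, d2).

Lemma norm1_ge0 M : 0 <= norm1 M.
Proof. by apply: sumr_ge0 => i _; apply: sumr_ge0. Qed.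

Lemma norm1D M N : norm1 (M + N) <= norm1 M + norm1 N.
Proof.
rewrite /norm1 -big_split; apply: ler_sum => i _ /=.
by rewrite -big_split; apply: ler_sum => j _; rewrite mxE ler_normD.
Qed.

Lemma norm1Z c M : norm1 (c *: M) = `|c| * norm1 M.
Proof.
rewrite /norm1 mulr_sumr; apply: eq_bigr => i _.
by rewrite mulr_sumr; apply: eq_bigr => j _; rewrite mxE normrM.
Qed.

Lemma norm1N M : norm1 (- M) = norm1 M.
Proof. by rewrite -scaleN1r norm1Z normrN1 mul1r. Qed.

Lemma norm1_0 : norm1 (0 : 'M[R]_(d1, d2)) = 0.
Proof. by rewrite -(scale0r 0) norm1Z normr0 mul0r. Qed.

Lemma norm1_sum (J : finType) (F : J -> 'M[R]_(d1, d2)) :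
  norm1 (\sum_k F k) <= \sum_k norm1 (F k).
Proof.
elim/big_rec2: _ => [|k y A _ IH]; first by rewrite norm1_0.
by apply: le_trans (norm1D _ _) _; rewrite lerD2l.
Qed.

Lemma norm1_nonneg M : (forall i j, 0 <= M i j) -> norm1 M = \sum_i \sum_j M i j.
Proof.
by move=> h; apply: eq_bigr => i _; apply: eq_bigr => j _; rewrite ger0_norm.
Qed.

Lemma norm1_eq0 M : (norm1 M == 0) = (M == 0).
Proof.
apply/idP/eqP => [|->]; last by rewrite norm1_0.
rewrite psumr_eq0; last by move=> i _; apply: sumr_ge0.
move=> /allP h; apply/matrixP => i j; rewrite mxE; apply/eqP.
have /= := h i (mem_index_enum _); rewrite psumr_eq0 //.
by move=> /allP/(_ j (mem_index_enum _)) /=; rewrite normr_eq0.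
Qed.

Lemma norm1_row_sum M : \sum_i norm1 (row i M) = norm1 M.
Proof.
by apply: eq_bigr => i _; rewrite /norm1 big_ord1; apply: eq_bigr => j _; rewrite mxE.
Qed.

Lemma norm1_col_sum M : \sum_j norm1 (col j M) = norm1 M.
Proof.
rewrite /norm1 [RHS]exchange_big; apply: eq_bigr => j _; apply: eq_bigr => i _.
by rewrite big_ord1 mxE.
Qed.

Lemma norm1_pos_part_le M P : (forall i j, 0 <= P i j) ->
  norm1 (pos_part M - P) <= norm1 (M - P).
Proof.
move=> P0; apply: ler_sum => i _; apply: ler_sum => j _; rewrite !mxE.
have := P0 i j; case: (leP (M i j) 0) => // M0 Pij.
rewrite sub0r normrN (ger0_norm Pij).
by rewrite distrC ger0_norm ?subr_ge0 ?(le_trans M0) // lerBrDl gerDr.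
Qed.

(** Renormalization moves [M] by [`|norm1 M - 1|], which is at most the error
    because [norm1 P = 1]. *)
Lemma norm1_normalize_le M P : (forall i j, 0 <= M i j) -> M != 0 -> norm1 P = 1 ->
  norm1 ((norm1 M)^-1 *: M - P) <= 2 * norm1 (M - P).
Proof.
move=> M0 Mn P1; have m0 : 0 < norm1 M by rewrite lt0r norm1_eq0 Mn norm1_ge0.
have -> : (norm1 M)^-1 *: M - P = ((norm1 M)^-1 - 1) *: M + (M - P).
  by rewrite scalerBl scale1r addrA subrK.
apply: le_trans (norm1D _ _) _; rewrite mulr_natl mulr2n lerD2r norm1Z.
rewrite -[X in _ * X](gtr0_norm m0) -normrM mulrBl mulVf ?gt_eqF // mul1r.
have h1 := norm1D (M - P) P; have h2 := norm1D (P - M) M.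
move: h1 h2; rewrite !subrK -[P - M]opprB norm1N P1 => h1 h2.
rewrite ler_norml; lra.
Qed.

Lemma norm1_support_le M (A : {set 'I_d1}) (B : {set 'I_d2}) :
  (forall i j, ~~ ((i \in A) && (j \in B)) -> M i j = 0) ->
  norm1 M <= Num.sqrt ((#|A| * #|B|)%:R * frob2 M).
Proof.
move=> supp; rewrite -[norm1 M]ger0_norm ?norm1_ge0 // -sqrtr_sqr ler_wsqrtr //.
pose b (p : 'I_d1 * 'I_d2) : bool := (p.1 \in A) && (p.2 \in B).
have -> : norm1 M = \sum_p (b p)%:R * `|M p.1 p.2|.
  rewrite /norm1 pair_bigA; apply: eq_bigr => -[i j] _ /=.
  by rewrite /b /=; case: (boolP (_ && _)) => [_|/supp ->]; rewrite ?mul1r // normr0 mulr0.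
apply: le_trans (sqr_sum_mul_le _ _) _.
rewrite le_eqVlt; apply/orP; left; apply/eqP; congr (_ * _).
  rewrite -cardsX -sum1_card natr_sum [RHS]big_mkcond /=; apply: eq_bigr => -[i j] _.
  by rewrite inE /b /=; case: (_ && _); rewrite ?expr1n ?expr0n.
rewrite /frob2 pair_bigA; apply: eq_bigr => p _.
by rewrite -normrX ger0_norm // sqr_ge0.
Qed.

End Norm1.

(** * Dyadic levels *)

Section Levels.
Context {R : realType}.

(** The indicator of level [t] is a difference of indicators of consecutive
    half-lines, so the sum telescopes. *)
Lemma sum_in_level T (x : R) : x <= 1 -> \sum_(t < T.+2) (in_level T t x)%:R = 1 :> R.
Proof.
move=> x1; rewrite big_ord_recr /= /in_level ltnn.
have E m : (m <= T.+1)%N -> \sum_(t < m) (in_level T t x)%:R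
    = 1 - (x <= 2 ^- m)%R%:R :> R.
  elim: m => [|m IH] hm; first by rewrite big_ord0 expr0 invr1 x1 subrr.
  rewrite big_ord_recr /= IH 1?ltnW // /in_level -ltnS hm.
  have : 2 ^- m.+1 <= 2 ^- m :> R.
    by rewrite lef_pV2 ?posrE ?exprn_gt0 // ler_weXn2l // ler1n.
  case: (leP x (2 ^- m.+1)) => [a b|a b]; first by rewrite (le_trans a b) /= addr0.
  by case: (leP x (2 ^- m)) => c; rewrite /= ?subr0 ?addr0 ?subrr ?add0r.
have := E T.+1 (leqnn _); rewrite /in_level => ->; by rewrite subrK.
Qed.

Context {d1 d2 : nat}.
Implicit Types H P : 'M[R]_(d1, d2).

Lemma level_blockE T t t' H1 H2 :
  level_block T t t' H1 H2 = block_part (row_level T t H1) (col_level T t' H1) H2.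
Proof. by []. Qed.

Lemma norm1_row_le H i : norm1 (row i H) <= norm1 H.
Proof.
rewrite -(norm1_row_sum H) (bigD1 i) //= lerDl.
by apply: sumr_ge0 => k _; exact: norm1_ge0.
Qed.

Lemma norm1_col_le H j : norm1 (col j H) <= norm1 H.
Proof.
rewrite -(norm1_col_sum H) (bigD1 j) //= lerDl.
by apply: sumr_ge0 => k _; exact: norm1_ge0.
Qed.

Lemma sum_level_block T H P : norm1 H = 1 ->
  \sum_(t < T.+2) \sum_(t' < T.+2) level_block T t t' H P = P.
Proof.
move=> H1; apply/matrixP => i j; rewrite summxE.
under eq_bigr do rewrite summxE.
have E (t t' : 'I_T.+2) : level_block T t t' H P i j =
    (in_level T t (norm1 (row i H)))%:R * ((in_level T t' (norm1 (col j H)))%:R * P i j).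
  rewrite mxE !inE.
  by case: (in_level T t _); case: (in_level T t' _); rewrite /= ?mul1r ?mul0r.
under eq_bigr do (under eq_bigr do rewrite E).
under eq_bigr do rewrite -mulr_sumr -mulr_suml.
rewrite -mulr_suml !sum_in_level ?mul1r // -H1; [exact: norm1_col_le|exact: norm1_row_le].
Qed.

Lemma last_level_gt d : (2 <= d)%N -> (d < 2 ^ (last_level d).+2)%N.
Proof.
move=> d2_; rewrite /last_level prednK ?trunc_log_ltn //.
by rewrite trunc_log_gt0 /= (leq_trans _ d2_).
Qed.

Lemma last_level_le d : (2 <= d)%N -> (2 ^ (last_level d).+1 <= d)%N.
Proof.
move=> d2_; rewrite /last_level prednK; last by rewrite trunc_log_gt0 /= (leq_trans _ d2_).
by apply: trunc_logP => //; exact: leq_trans d2_.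
Qed.

End Levels.

(** Each line of a level [t <= T] carries mass at least [2 ^- t.+1] out of a
    total of one; for the last level the number of all lines is enough. *)
Lemma card_level (R : realType) d m t (f : 'I_m -> R) : (2 <= d)%N -> (m <= d)%N ->
  (forall i, 0 <= f i) -> \sum_i f i = 1 -> (t <= (last_level d).+1)%N ->
  (#|[set i | in_level (last_level d) t (f i)]| <= 2 ^ t.+1)%N.
Proof.
move=> d2_ md f0 f1; rewrite leq_eqVlt => /orP[/eqP ->|].
  apply: leq_trans (max_card _) _; rewrite card_ord (leq_trans md) //.
  exact/ltnW/last_level_gt.
rewrite ltnS => tT; rewrite -(ler_nat R) natrX.
have p0 : 0 < (2 : R) ^+ t.+1 by rewrite exprn_gt0.
rewrite -[leRHS]mul1r -ler_pdivrMr // -[leRHS]f1 mulrC -sum1_card natr_sum mulr_sumr.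
rewrite [leRHS](bigID (fun i => i \in [set i | in_level (last_level d) t (f i)])) /=.
rewrite -[leLHS]addr0 lerD //; last exact: sumr_ge0.
apply: ler_sum => i; rewrite inE /in_level tT => /andP[/ltW h _].
by rewrite mulr1.
Qed.

(** * Deterministic error of the sum of the blocks *)

Lemma rank_block_part (R : realType) d1 d2 (A : {set 'I_d1}) (B : {set 'I_d2})
    (M : 'M[R]_(d1, d2)) : (\rank (block_part A B M) <= \rank M)%N.
Proof.
have -> : block_part A B M =
    diag_mx (\row_i (i \in A)%:R) *m M *m diag_mx (\row_j (j \in B)%:R).
  apply/matrixP => i j; rewrite mul_mx_diag mul_diag_mx !mxE.
  by case: (i \in A); case: (j \in B); rewrite /= ?mul1r ?mulr1 ?mul0r ?mulr0.
by rewrite (leq_trans (mxrankM_maxl _ _)) // mxrankM_maxr.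
Qed.

Lemma sum_sqrt2_powers (R : realType) m :
  \sum_(t < m) Num.sqrt 2 ^+ t <= 4 * Num.sqrt 2 ^+ m :> R.
Proof.
have s0 : 5 / 4 <= Num.sqrt 2 :> R.
  rewrite -[leLHS]ger0_norm; last by lra.
  by rewrite -sqrtr_sqr ler_wsqrtr //; lra.
elim: m => [|m IH]; first by rewrite big_ord0 expr0; lra.
rewrite big_ord_recr /= exprS.
have p0 : 0 <= Num.sqrt 2 ^+ m :> R by rewrite exprn_ge0 ?sqrtr_ge0.
have := ler_wpM2r p0 s0; lra.
Qed.

Section BlockSumError.
Context {R : realType} {d1 d2 d N n K : nat} (alpha : R).
Context (H1 H2 P : 'M[R]_(d1, d2)).
Hypotheses (d_ge2 : (2 <= d)%N) (d1d : (d1 <= d)%N) (d2d : (d2 <= d)%N).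
Hypotheses (N0 : (0 < N)%N) (alpha0 : 0 <= alpha) (H1_1 : norm1 H1 = 1) (rP : (\rank P <= K)%N).
Let T := last_level d.

Hypothesis noise : forall t t' : nat, (t <= T.+1)%N -> (t' <= T.+1)%N ->
  opbound (threshold alpha N n t t' / 2)
    (level_block T t t' H1 H2 - level_block T t t' H1 P).

Let a := alpha * (ln N%:R / n%:R).

(** The block of level [(t, t')] has at most [2 ^ t.+1] rows and [2 ^ t'.+1]
    columns and supports the estimate, which converts the Frobenius error into
    an l1 error. *)
Lemma level_block_error (t t' : nat) : (t <= T.+1)%N -> (t' <= T.+1)%N ->
  norm1 (nuclear_prox (threshold alpha N n t t') (level_block T t t' H1 H2)
         - level_block T t t' H1 P)
  <= 12 * Num.sqrt (8 * K%:R * a) * (Num.sqrt 2 ^+ t + Num.sqrt 2 ^+ t').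
Proof.
move=> tT tT'.
set th := threshold alpha N n t t'; set A := row_level T t H1; set B := col_level T t' H1.
have a0 : 0 <= a by rewrite mulr_ge0 // divr_ge0 // ln_ge0 // ler1n.
have th0 : 0 <= th by rewrite mulr_ge0 // sqrtr_ge0.
have thE : th = 2 * (th / 2) by field.
have th20 : 0 <= th / 2 by rewrite divr_ge0.
have rb : (\rank (level_block T t t' H1 P) <= K)%N.
  by rewrite level_blockE (leq_trans (rank_block_part _ _ _)).
have err := nuclear_prox_error th20 (noise tT tT') rb.
have off (M : 'M[R]_(d1, d2)) i j : ~~ ((i \in A) && (j \in B)) -> level_block T t t' H1 M i j = 0.
  by move=> h; rewrite mxE (negbTE h).
have supp i j : ~~ ((i \in A) && (j \in B)) ->
    (nuclear_prox th (level_block T t t' H1 H2) - level_block T t t' H1 P) i j = 0.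
  move=> h; rewrite !mxE (negbTE h) subr0 thE.
  by rewrite (nuclear_prox_support th20 (off H2)).
apply: le_trans (norm1_support_le supp) _.
have cA : (#|A| <= 2 ^ t.+1)%N.
  by apply: card_level => // [i|]; rewrite ?norm1_row_sum // norm1_ge0.
have cB : (#|B| <= 2 ^ t'.+1)%N.
  by apply: card_level => // [i|]; rewrite ?norm1_col_sum // norm1_ge0.
have le1 : (#|A| * #|B|)%:R * frob2 (nuclear_prox th (level_block T t t' H1 H2)
    - level_block T t t' H1 P) <= (2 ^ (t.+1 + t'.+1))%:R * ((2 * K)%:R * th ^+ 2).
  apply: ler_pM; rewrite ?ler0n ?frob2_ge0 //; last by rewrite {1}thE {2}thE.
  by rewrite ler_nat expnD leq_mul.
apply: le_trans (ler_wsqrtr le1) _.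
have thsq : th ^+ 2 = 144 * (a * 2 ^- minn t t').
  rewrite /th /threshold exprMn sqr_sqrtr; last by rewrite mulr_ge0 // invr_ge0 exprn_ge0.
  by rewrite /a; ring.
have -> : (2 ^ (t.+1 + t'.+1))%:R * ((2 * K)%:R * th ^+ 2) =
    12 ^+ 2 * (8 * K%:R * a) * 2 ^+ maxn t t' :> R.
  have -> : (t.+1 + t'.+1)%N = (minn t t' + maxn t t' + 2)%N by rewrite addn_min_max; lia.
  rewrite thsq natrX natrM 2!exprD.
  have p0 : 2 ^+ minn t t' != 0 :> R by rewrite expf_neq0.
  by field.
have p8 : 0 <= 8 * K%:R * a by apply: mulr_ge0 => //; exact: mulr_ge0.
have p12 : 0 <= 12 ^+ 2 * (8 * K%:R * a) by rewrite mulr_ge0 ?sqr_ge0.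
rewrite (sqrtrM _ p12) (sqrtrM _ (sqr_ge0 12)) sqrtr_sqr (@ger0_norm _ 12) //.
rewrite ler_wpM2l ?mulr_ge0 ?sqrtr_ge0 //.
have -> m : Num.sqrt (2 ^+ m) = Num.sqrt 2 ^+ m :> R.
  elim: m => [|m IH]; first by rewrite !expr0 sqrtr1.
  by rewrite !exprS sqrtrM // IH.
have s0 m : 0 <= Num.sqrt 2 ^+ m :> R by rewrite exprn_ge0 ?sqrtr_ge0.
by case: (leqP t t') => _; rewrite ?lerDl ?lerDr.
Qed.

(** Summed over the pairs of levels, the bound is geometric in one of the two
    levels and constant in the other. This gives one factor [T.+2] and
    one factor of order [Num.sqrt d%:R], because [2 ^ T.+1 <= d]. *)
Theorem block_sum_error :
  norm1 (block_sum alpha d N n H1 H2 - P) <=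
  384 * T.+2%:R * Num.sqrt (alpha * (ln N%:R / n%:R) * (K * d)%:R).
Proof.
have s0 m : 0 <= Num.sqrt 2 ^+ m :> R by rewrite exprn_ge0 ?sqrtr_ge0.
have a0 : 0 <= a by rewrite mulr_ge0 // divr_ge0 // ln_ge0 // ler1n.
rewrite -(sum_level_block T P H1_1) /block_sum -/T -sumrB.
apply: le_trans (norm1_sum _) _.
set c := 12 * Num.sqrt (8 * K%:R * a).
apply: (@le_trans _ _ (\sum_(t < T.+2) \sum_(t' < T.+2) c * (Num.sqrt 2 ^+ t + Num.sqrt 2 ^+ t'))).
  apply: ler_sum => t _; rewrite -sumrB; apply: le_trans (norm1_sum _) _.
  by apply: ler_sum => t' _; apply: level_block_error; rewrite -ltnS ltn_ord.
have -> : \sum_(t < T.+2) \sum_(t' < T.+2) c * (Num.sqrt 2 ^+ t + Num.sqrt 2 ^+ t') =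
    c * (2 * T.+2%:R * \sum_(t < T.+2) Num.sqrt 2 ^+ t).
  under eq_bigr do rewrite -mulr_sumr big_split sumr_const card_ord /=.
  rewrite -mulr_sumr big_split sumr_const card_ord /= sumrMnl.
  by rewrite -mulr_natl; congr (_ * _); ring.
have c0 : 0 <= c by rewrite mulr_ge0 ?sqrtr_ge0.
apply: (@le_trans _ _ (c * (2 * T.+2%:R * (4 * Num.sqrt (2 * d%:R))))).
  rewrite ler_wpM2l // ler_wpM2l ?mulr_ge0 //.
  apply: le_trans (sum_sqrt2_powers _ _) _; rewrite ler_wpM2l //.
  rewrite exprS sqrtrM // ler_wpM2l ?sqrtr_ge0 //.
  have -> : Num.sqrt 2 ^+ T.+1 = Num.sqrt ((2 ^ T.+1)%:R) :> R.
    rewrite natrX; elim: T.+1 => [|m IH]; first by rewrite !expr0 sqrtr1.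
    by rewrite !exprS sqrtrM // IH.
  by rewrite ler_wsqrtr // ler_nat last_level_le.
have E : Num.sqrt (8 * K%:R * a) * Num.sqrt (2 * d%:R) =
    4 * Num.sqrt (alpha * (ln N%:R / n%:R) * (K * d)%:R).
  rewrite -sqrtrM ?natrM -/a; last by apply: mulr_ge0 => //; exact: mulr_ge0.
  have -> : 8 * K%:R * a * (2 * d%:R) = 4 ^+ 2 * (a * (K%:R * d%:R)) by ring.
  by rewrite sqrtrM ?exprn_ge0 // sqrtr_sqr ger0_norm.
rewrite le_eqVlt; apply/orP; left; apply/eqP.
rewrite /c (_ : _ * _ = 12 * 2 * 4 * T.+2%:R * (Num.sqrt (8 * K%:R * a) * Num.sqrt (2 * d%:R))); last by ring.
by rewrite E; ring.
Qed.

End BlockSumError.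

(** * Loss of the algorithm *)

Section AlgorithmLoss.
Context {R : realType} {d1 d2 : nat}.
Implicit Types H P : 'M[R]_(d1, d2).

Definition is_law P := (forall i j, 0 <= P i j) /\ \sum_i \sum_j P i j = 1.

Lemma norm1_law P : is_law P -> norm1 P = 1.
Proof. by case=> P0 P1; rewrite norm1_nonneg. Qed.

Lemma norm1_alg1_le1 alpha d N n H1 H2 : is_law H1 -> is_law H2 ->
  norm1 (alg1 alpha d N n H1 H2) <= 1.
Proof.
move=> /norm1_law h1 /norm1_law h2; rewrite /alg1; case: ifP => [_|/negbT].
  rewrite norm1Z ger0_norm ?invr_ge0 //.
  by have := norm1D H1 H2; rewrite h1 h2; lra.
rewrite negb_or => /andP[_ Pn]; rewrite norm1Z ger0_norm ?invr_ge0 ?norm1_ge0 //.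
by rewrite mulVf // norm1_eq0.
Qed.

Lemma alg1_loss_le2 alpha d N n H1 H2 P : is_law H1 -> is_law H2 -> is_law P ->
  norm1 (alg1 alpha d N n H1 H2 - P) <= 2.
Proof.
move=> h1 h2 /norm1_law hP; apply: le_trans (norm1D _ _) _.
by rewrite norm1N hP; have := norm1_alg1_le1 alpha d N n h1 h2; lra.
Qed.

(** If the positive part vanishes, the error of [block_sum] is at least
    [norm1 P = 1], so the trivial bound [2] is already of the right form. *)
Lemma alg1_loss_le alpha d N n H1 H2 P : is_law H1 -> is_law H2 -> is_law P ->
  14 * alpha * d%:R * ln N%:R <= n%:R ->
  norm1 (alg1 alpha d N n H1 H2 - P) <= 2 * norm1 (block_sum alpha d N n H1 H2 - P).
Proof.
move=> h1 h2 hP large; have [P0 P1] := hP; have nP := norm1_law hP.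
have pp := norm1_pos_part_le (block_sum alpha d N n H1 H2) P0.
have pos i j : 0 <= pos_part (block_sum alpha d N n H1 H2) i j.
  by rewrite mxE le_max lexx orbT.
have [z|nz] := eqVneq (pos_part (block_sum alpha d N n H1 H2)) 0.
  apply: le_trans (alg1_loss_le2 _ _ _ _ h1 h2 hP) _.
  by move: pp; rewrite z sub0r norm1N nP; lra.
rewrite /alg1 ltNge large /= (negbTE nz).
apply: le_trans (norm1_normalize_le pos nz nP) _; lra.
Qed.

Lemma freq_law n (x : {ffun 'I_n -> 'I_d1 * 'I_d2}) : (0 < n)%N -> is_law (freq R x).
Proof.
move=> n0; split => [i j|]; first by rewrite mxE divr_ge0.
rewrite pair_bigA; under eq_bigr do rewrite mxE.
rewrite -mulr_suml -natr_sum.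
have -> : (\sum_(p : 'I_d1 * 'I_d2) #|[set k | x k == (p.1, p.2)]|)%N = n.
  rewrite -[RHS]card_ord -sum1_card (partition_big x xpredT) //=.
  apply: eq_bigr => p _; rewrite -sum1_card; apply: eq_bigl => k.
  by rewrite inE -surjective_pairing.
by rewrite divff // pnatr_eq0 -lt0n.
Qed.

End AlgorithmLoss.

(** * Risk over a split sample *)

Section SplitSampleRisk.
Context {R : realType} {d1 d2 n : nat} (alpha : R) (P : 'M[R]_(d1, d2)).
Let d := maxn d1 d2.
Let T := last_level d.
Let L : R := ln n%:R.
Hypotheses (lawP : is_law P) (alpha_ge : 3 / 2 <= alpha).
Hypotheses (d1_ge2 : (2 <= d1)%N) (n_ge2 : (2 <= n)%N).
Hypothesis large : 14 * alpha * d%:R * L <= n%:R.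

Local Notation Obs := ('I_d1 * 'I_d2)%type.
Local Notation sample := {ffun 'I_n -> Obs}.
Let q (y : Obs) : R := P y.1 y.2.

Let n0 : (0 < n)%N. Proof. exact: leq_trans n_ge2. Qed.
Let nR0 : 0 < n%:R :> R. Proof. by rewrite ltr0n. Qed.
Let d_ge2 : (2 <= d)%N. Proof. by rewrite leq_max d1_ge2. Qed.
Let q0 y : 0 <= q y. Proof. by case: lawP => P0 _; exact: P0. Qed.
Let q1 : \sum_y q y = 1. Proof. by case: lawP => _; exact: law_sum1. Qed.

Lemma ln_nat_ge_half : 1 / 2 <= L.
Proof.
apply: (@le_trans _ _ (ln 2)); last by rewrite ler_ln ?posrE ?ltr0n // ler_nat.
rewrite -ler_expR lnK ?posrE //.
rewrite -[leRHS]invrK -[leLHS]invrK -expRN lef_pV2 ?posrE ?expR_gt0 ?invr_gt0 //.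
by apply: le_trans (expR_ge1Dx _); lra.
Qed.

(** The constant is [21 = 14 * (3 / 2)], by the bound [2 ^ T.+1 <= d]. *)
Let level_scale_ge (t : nat) : (t <= T.+1)%N -> 21 * L <= n%:R * 2 ^- t.
Proof.
move=> tT; have L0 := ln_nat_ge_half.
have dR0 : 0 < d%:R :> R by rewrite ltr0n (leq_trans _ d_ge2).
have h1 : d%:R^-1 <= 2 ^- t :> R.
  rewrite lef_pV2 ?posrE ?exprn_gt0 // -natrX ler_nat.
  by rewrite (leq_trans _ (last_level_le d_ge2)) // leq_exp2l.
apply: (@le_trans _ _ (n%:R / d%:R)); last by rewrite ler_wpM2l.
rewrite ler_pdivlMr //; apply: le_trans large.
have := ler_wpM2r (ltW dR0) alpha_ge; have := mulr_ge0 (ltW dR0) (_ : 0 <= L).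
move=> /(_ ltac:(lra)) dL /(ler_wpM2r (_ : 0 <= L)) => /(_ ltac:(lra)); lra.
Qed.

Lemma expR_m2ln : expR (- (2 * L)) = n%:R ^- 2.
Proof. by rewrite expRN expRM_natl lnK // posrE. Qed.

(** The two bad events of the first half of the sample: a line whose mass is
    above the resolution of the levels looks more than twice too light. *)
Definition few_row (i : 'I_d1) (x : sample) : bool :=
  (2 * 2 ^- T.+1 < \sum_j P i j) && (norm1 (row i (freq R x)) < (\sum_j P i j) / 2).

Definition few_col (j : 'I_d2) (x : sample) : bool :=
  (2 * 2 ^- T.+1 < \sum_i P i j) && (norm1 (col j (freq R x)) < (\sum_i P i j) / 2).

Lemma norm1_row_freq i (x : sample) :
  norm1 (row i (freq R x)) = hits (fun y => y.1 == i) x / n%:R.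
Proof.
rewrite norm1_nonneg; last by move=> a j; rewrite !mxE divr_ge0.
rewrite big_ord1; under eq_bigr do rewrite !mxE.
rewrite -mulr_suml; congr (_ / _); rewrite -natr_sum /hits -natr_sum; congr (_%:R).
under eq_bigr do rewrite -sum1_card big_mkcond /=.
rewrite exchange_big; apply: eq_bigr => k _.
under eq_bigr do rewrite inE -pair_eqE /=.
case: eqP => _ /=; last by rewrite big1.
by rewrite (bigD1 (x k).2) //= eqxx big1 // => j /negbTE; rewrite eq_sym => ->.
Qed.

Lemma norm1_col_freq j (x : sample) :
  norm1 (col j (freq R x)) = hits (fun y => y.2 == j) x / n%:R.
Proof.
rewrite norm1_nonneg; last by move=> a b; rewrite !mxE divr_ge0.
under eq_bigr do rewrite big_ord1 !mxE.
rewrite -mulr_suml; congr (_ / _); rewrite -natr_sum /hits -natr_sum; congr (_%:R).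
under eq_bigr do rewrite -sum1_card big_mkcond /=.
rewrite exchange_big; apply: eq_bigr => k _.
under eq_bigr do rewrite inE -pair_eqE /= andbC.
case: eqP => _ /=; last by rewrite big1.
by rewrite (bigD1 (x k).1) //= eqxx big1 // => i /negbTE; rewrite eq_sym => ->.
Qed.

Lemma hit_prob_row i : hit_prob q (fun y => y.1 == i) = \sum_j P i j.
Proof.
rewrite /hit_prob -(pair_bigA _ (fun a b => q (a, b) * (a == i)%:R)) /=.
rewrite (bigD1 i) //= [X in _ + X]big1 ?addr0; last first.
  by move=> a /negbTE ai; rewrite big1 // => b _; rewrite ai mulr0.
by apply: eq_bigr => b _; rewrite eqxx mulr1.
Qed.

Lemma hit_prob_col j : hit_prob q (fun y => y.2 == j) = \sum_i P i j.
Proof.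
rewrite /hit_prob -(pair_bigA _ (fun a b => q (a, b) * (b == j)%:R)) /= exchange_big /=.
rewrite (bigD1 j) //= [X in _ + X]big1 ?addr0; last first.
  by move=> a /negbTE ai; rewrite big1 // => b _; rewrite ai mulr0.
by apply: eq_bigr => b _; rewrite eqxx mulr1.
Qed.

Lemma few_hits_tail (S : pred Obs) (f : sample -> R) :
  (forall x, f x = hits S x / n%:R) ->
  expect q (fun x => ((2 * 2 ^- T.+1 < hit_prob q S) && (f x < hit_prob q S / 2))%R%:R)
  <= n%:R ^- 2.
Proof.
move=> fE; case: (ltP (2 * 2 ^- T.+1) (hit_prob q S)) => /= h; last first.
  by rewrite expect_cst // invr_ge0 exprn_ge0.
apply: (@le_trans _ _ (expR (- (n%:R * hit_prob q S / 12)))).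
  have := @expect_few_hits R 'I_n Obs q q0 q1 S; rewrite card_ord.
  congr (_ <= _); apply: eq_expect => x; rewrite fE ltr_pdivrMr //.
  by congr (_%:R); congr (nat_of_bool _); congr (_ < _); ring.
rewrite -expR_m2ln ler_expR lerN2.
have := level_scale_ge (leqnn T.+1); have := ler_wpM2l (ltW nR0) (ltW h).
have := ln_nat_ge_half; lra.
Qed.

(** Outside the bad events, the empirical level of a line bounds its true mass,
    which is the variance of the noise in the second half of the sample. *)
Lemma row_level_mass (x : sample) (t : nat) i : (t <= T.+1)%N -> ~~ few_row i x ->
  i \in row_level T t (freq R x) -> \sum_j P i j <= 2 * 2 ^- t.
Proof.
move=> tT few; rewrite inE /in_level => lev; rewrite leNgt; apply/negP => big_.
have ge_ : norm1 (row i (freq R x)) <= 2 ^- t.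
  by move: lev; case: leqP => [_ /andP[]//|lt_]; have -> : t = T.+1 by lia.
have mono : 2 ^- T.+1 <= 2 ^- t :> R.
  by rewrite lef_pV2 ?posrE ?exprn_gt0 // ler_weXn2l // ler1n.
move/negP: few; apply; rewrite /few_row; apply/andP; split; lra.
Qed.

Lemma col_level_mass (x : sample) (t : nat) j : (t <= T.+1)%N -> ~~ few_col j x ->
  j \in col_level T t (freq R x) -> \sum_i P i j <= 2 * 2 ^- t.
Proof.
move=> tT few; rewrite inE /in_level => lev; rewrite leNgt; apply/negP => big_.
have ge_ : norm1 (col j (freq R x)) <= 2 ^- t.
  by move: lev; case: leqP => [_ /andP[]//|lt_]; have -> : t = T.+1 by lia.
have mono : 2 ^- T.+1 <= 2 ^- t :> R.
  by rewrite lef_pV2 ?posrE ?exprn_gt0 // ler_weXn2l // ler1n.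
move/negP: few; apply; rewrite /few_col; apply/andP; split; lra.
Qed.

(** The moment used is the integer part of [2 ln n]. Each factor of the moment
    bound is then at most [1 / e], which gives the power [n ^- 2]; this is where
    the constants 12 and 14 of the procedure and the bound [3 / 2 <= alpha]
    enter. *)
Lemma level_block_tail (x1 : sample) (t t' : nat) :
  (t <= T.+1)%N -> (t' <= T.+1)%N ->
  (forall i, ~~ few_row i x1) -> (forall j, ~~ few_col j x1) ->
  expect q (fun x2 : sample => (~~ `[< opbound (threshold alpha n n t t' / 2)
    (level_block T t t' (freq R x1) (freq R x2) - level_block T t t' (freq R x1) P) >])%:R)
  <= (d1 + d2)%:R * (expR 1 * n%:R ^- 2).
Proof.
move=> tT tT' good_rows good_cols; have L0 := ln_nat_ge_half.
set s : R := 2 ^- minn t t'; set l := threshold alpha n n t t' / 2.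
have s0 : 0 < s by rewrite invr_gt0 exprn_gt0.
have mT : (minn t t' <= T.+1)%N by rewrite geq_min tT.
have scale := level_scale_ge mT; rewrite -/s in scale.
have Lp : 0 < L by lra.
have ap : 0 < alpha by apply: lt_le_trans alpha_ge.
have aL0 : 0 < alpha * (L / n%:R) * s.
  by rewrite mulr_gt0 // mulr_gt0 // divr_gt0.
have l0 : 0 < l by rewrite divr_gt0 // mulr_gt0 // sqrtr_gt0.
have lsq : (n%:R * l) ^+ 2 = 36 * (alpha * L * (n%:R * s)).
  rewrite /l /threshold exprMn exprMn exprMn sqr_sqrtr ?(ltW aL0) //.
  by rewrite -/L -/s; field; rewrite gt_eqF.
have le_s (u : nat) : (minn t t' <= u)%N -> 2 ^- u <= s.
  by move=> hu; rewrite lef_pV2 ?posrE ?exprn_gt0 // ler_weXn2l // ler1n.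
have [p0 p_le] : (0 < Num.trunc (2 * L))%N /\ (Num.trunc (2 * L))%:R <= 2 * L.
  by rewrite truncn_gt0 truncn_le; split; lra.
have p_gt : 2 * L < (Num.trunc (2 * L)).+1%:R := truncnS_gt _.
case: (Num.trunc (2 * L)) p0 p_le p_gt => // r _ p_le p_gt.
have rows a : a \in row_level T t (freq R x1) -> \sum_b P a b <= 2 * s.
  move=> /(row_level_mass tT (good_rows a)) h; apply: le_trans h _.
  by rewrite ler_wpM2l // le_s // geq_minl.
have cols b : b \in col_level T t' (freq R x1) -> \sum_a P a b <= 2 * s.
  move=> /(col_level_mass tT' (good_cols b)) h; apply: le_trans h _.
  by rewrite ler_wpM2l // le_s // geq_minr.
have s20 : 0 <= 2 * s by rewrite mulr_ge0 // ltW.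
have [P0 P1] := lawP.
have := block_noise_tail P0 P1 r n0 s20 l0 rows cols.
move=> tail; apply: le_trans tail _; rewrite ler_wpM2l //.
(* Numerically the ratio is at most 0.304, while [(3 / 4) ^+ 4] exceeds 0.316. *)
have ratio : (r.*2).+1%:R * (2 * (n%:R * (2 * s)) + r.+1%:R) / (n%:R * l) ^+ 2 <= expR (-1).
  have e14 : 3 / 4 <= expR (- (1 / 4)) :> R by apply: le_trans (expR_ge1Dx _); lra.
  have e1 : (3 / 4) ^+ 4 <= expR (-1) :> R.
    have -> : -1 = 4%:R * - (1 / 4) :> R by field.
    by rewrite expRM_natl lerXn2r ?nnegrE ?expR_ge0 //; lra.
  have ns0 : 0 < n%:R * s by rewrite mulr_gt0.
  have Lns0 : 0 < L * (n%:R * s) by rewrite mulr_gt0 //; lra.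
  apply: le_trans e1; rewrite lsq ler_pdivrMr; last by rewrite !mulr_gt0 //; lra.
  have k1 : (r.*2).+1%:R <= 4 * L.
    have : (r.*2).+1%:R <= 2 * r.+1%:R :> R by rewrite -natrM ler_nat mul2n doubleS.
    lra.
  (* The correction [2 / 21] comes from [r.+1 <= 2 * L] and [21 * L <= n * s]. *)
  have k2 : 2 * (n%:R * (2 * s)) + r.+1%:R <= (4 + 2 / 21) * (n%:R * s) by lra.
  have k3 : (r.*2).+1%:R * (2 * (n%:R * (2 * s)) + r.+1%:R) <=
      4 * L * ((4 + 2 / 21) * (n%:R * s)).
    by apply: ler_pM => //; rewrite addr_ge0 // !mulr_ge0 // ltW.
  have k4 : 3 / 2 * (L * (n%:R * s)) <= alpha * L * (n%:R * s).
    by rewrite -[leRHS]mulrA ler_wpM2r // ltW.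
  apply: le_trans k3 _; rewrite !exprS expr0; lra.
apply: (@le_trans _ _ (expR (-1) ^+ r.+1)).
  rewrite lerXn2r ?nnegrE ?expR_ge0 // divr_ge0 ?sqr_ge0 // mulr_ge0 // addr_ge0 //.
  by rewrite mulr_ge0 // mulr_ge0.
rewrite -expRM_natl -expR_m2ln -expRD ler_expR.
by move: p_gt; rewrite -[r.+2%:R]natr1; lra.
Qed.

(** Three contributions: the deterministic error when all blocks are quiet, the
    failure of the noise bound for some pair of levels, and the failure of the
    first half of the sample to rank the lines. The loss is at most [2] on the
    last two events. *)
Lemma split_sample_risk K : (\rank P <= K)%N ->
  expect q (fun x1 : sample => expect q (fun x2 : sample =>
    norm1 (alg1 alpha d n n (freq R x1) (freq R x2) - P)))
  <= 2 * (384 * T.+2%:R * Num.sqrt (alpha * (L / n%:R) * (K * d)%:R))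
     + 2 * (T.+2%:R ^+ 2 * ((d1 + d2)%:R * (expR 1 * n%:R ^- 2)))
     + 2 * ((d1 + d2)%:R * n%:R ^- 2).
Proof.
move=> rP; set eps := 384 * _ * _; set tail := _ * (expR 1 * _).
have L0 := ln_nat_ge_half.
have lawF (x : sample) : is_law (freq R x) := freq_law x n0.
have eps0 : 0 <= eps.
  by apply: mulr_ge0; [apply: mulr_ge0; exact: ler0n | exact: sqrtr_ge0].
have eps20 : 0 <= 2 * eps := mulr_ge0 (ler0n R 2) eps0.
have tail0 : 0 <= tail by rewrite !mulr_ge0 ?expR_ge0 ?invr_ge0 ?exprn_ge0.
pose noisy (x1 x2 : sample) (t t' : nat) : bool :=
  ~~ `[< opbound (threshold alpha n n t t' / 2)
    (level_block T t t' (freq R x1) (freq R x2) - level_block T t t' (freq R x1) P) >].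
have loss (x1 x2 : sample) : norm1 (alg1 alpha d n n (freq R x1) (freq R x2) - P) <=
    2 * eps + 2 * \sum_(t < T.+2) \sum_(t' < T.+2) (noisy x1 x2 t t')%:R.
  have [/'exists_existsP [t [t' bad]]|] :=
    boolP [exists t : 'I_T.+2, exists t' : 'I_T.+2, noisy x1 x2 t t'].
    apply: le_trans (alg1_loss_le2 _ _ _ _ (lawF x1) (lawF x2) lawP) _.
    rewrite -[leLHS]mulr1 -[leLHS]add0r lerD // ler_wpM2l //.
    rewrite (bigD1 t) //= (bigD1 t') //= bad -!addrA lerDl addr_ge0 ?sumr_ge0 // => k _.
    exact: sumr_ge0.
  rewrite negb_exists => /forallP quiet.
  apply: (@le_trans _ _ (2 * eps)); last first.
    by rewrite lerDl mulr_ge0 // sumr_ge0 // => k _; exact: sumr_ge0.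
  apply: le_trans (alg1_loss_le (lawF x1) (lawF x2) lawP large) _.
  rewrite ler_wpM2l //; apply: block_sum_error => //; rewrite ?leq_maxl ?leq_maxr //.
  - exact: le_trans alpha_ge.
  - exact: norm1_law.
  move=> t t'; rewrite -!(ltnS _ T.+1) => tT tT'.
  have := quiet (Ordinal tT); rewrite negb_exists => /forallP/(_ (Ordinal tT')).
  by rewrite negbK => /asboolP.
have inner (x1 : sample) : expect q (fun x2 : sample => norm1 (alg1 alpha d n n (freq R x1) (freq R x2) - P)) <=
    2 * eps + 2 * (T.+2%:R ^+ 2 * tail)
    + 2 * (\sum_i (few_row i x1)%:R + \sum_j (few_col j x1)%:R).
  have rows0 : 0 <= \sum_i (few_row i x1)%:R :> R by exact: sumr_ge0.
  have cols0 : 0 <= \sum_j (few_col j x1)%:R :> R by exact: sumr_ge0.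
  have main0 : 0 <= 2 * eps + 2 * (T.+2%:R ^+ 2 * tail).
    by rewrite addr_ge0 // mulr_ge0 // mulr_ge0 // exprn_ge0.
  have bad_case : 1 <= \sum_i (few_row i x1)%:R + \sum_j (few_col j x1)%:R :> R ->
      expect q (fun x2 : sample => norm1 (alg1 alpha d n n (freq R x1) (freq R x2) - P)) <=
      2 * eps + 2 * (T.+2%:R ^+ 2 * tail)
      + 2 * (\sum_i (few_row i x1)%:R + \sum_j (few_col j x1)%:R).
    move=> h; apply: (@le_trans _ _ 2); last by lra.
    rewrite -[leRHS](@expect_cst R 'I_n Obs q q1); apply: expect_le => // x2.
    exact: alg1_loss_le2.
  have [/existsP[i bad]|/existsPn good_rows] := boolP [exists i, few_row i x1].
    apply: bad_case; rewrite (bigD1 i) //= bad -!addrA lerDl !addr_ge0 //.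
    exact: sumr_ge0.
  have [/existsP[j bad]|/existsPn good_cols] := boolP [exists j, few_col j x1].
    apply: bad_case; rewrite [X in _ + X](bigD1 j) //= bad addrCA lerDl !addr_ge0 //.
    exact: sumr_ge0.
  apply: (@le_trans _ _ (2 * eps + 2 * (T.+2%:R ^+ 2 * tail))); last by lra.
  apply: le_trans (expect_le q0 (loss x1)) _.
  rewrite expectD expect_cst // lerD2l expectZ ler_wpM2l // expect_sum.
  have -> : T.+2%:R ^+ 2 * tail = \sum_(t < T.+2) \sum_(t' < T.+2) tail.
    by rewrite !sumr_const card_ord -mulrnA -[RHS]mulr_natl natrM expr2.
  apply: ler_sum => t _; rewrite expect_sum; apply: ler_sum => t' _.
  by apply: level_block_tail => //; rewrite -ltnS.
apply: le_trans (expect_le q0 inner) _.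
rewrite expectD expect_cst // lerD2l expectZ ler_wpM2l // expectD !expect_sum natrD mulrDl.
apply: lerD.
  rewrite -[X in X%:R * _]card_ord -sum1_card natr_sum mulr_suml; apply: ler_sum => i _.
  rewrite mul1r; have := few_hits_tail (norm1_row_freq i).
  by rewrite hit_prob_row.
rewrite -[X in X%:R * _]card_ord -sum1_card natr_sum mulr_suml; apply: ler_sum => i _.
rewrite mul1r; have := few_hits_tail (norm1_col_freq i).
by rewrite hit_prob_col.
Qed.

End SplitSampleRisk.

Local Open Scope classical_set_scope.
Local Open Scope ring_scope.

(** * From the probability space to finite sums *)

Section SampleHalves.
Context {R : realType} {d1 d2 n : nat}.
Local Notation Obs := ('I_d1 * 'I_d2)%type.
Local Notation sample := {ffun 'I_n -> Obs}.

Lemma halves_size : (n + n = 2 * n)%N. Proof. by rewrite addnn mul2n. Qed.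

Definition first_ix (k : 'I_n) : 'I_(2 * n) := cast_ord halves_size (lshift n k).

Definition second_ix (k : 'I_n) : 'I_(2 * n) := cast_ord halves_size (rshift n k).

Lemma big_halves (V : Type) (idx : V) (op : Monoid.com_law idx) (F : 'I_(2 * n) -> V) :
  \big[op/idx]_k F k =
  op (\big[op/idx]_k F (first_ix k)) (\big[op/idx]_k F (second_ix k)).
Proof.
rewrite (reindex (cast_ord halves_size)) /=; last first.
  by exists (cast_ord (esym halves_size)) => k _; rewrite ?cast_ordK ?cast_ordKV.
by rewrite big_split_ord.
Qed.

Definition join_halves (x1 x2 : sample) (k : 'I_(2 * n)) : Obs :=
  match fintype.split (cast_ord (esym halves_size) k) with
  | inl i => x1 i
  | inr i => x2 i
  end.

Lemma join_first x1 x2 k : join_halves x1 x2 (first_ix k) = x1 k.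
Proof.
by rewrite /join_halves /first_ix cast_ordK -[lshift n k]/(unsplit (inl k)) unsplitK.
Qed.

Lemma join_second x1 x2 k : join_halves x1 x2 (second_ix k) = x2 k.
Proof.
by rewrite /join_halves /second_ix cast_ordK -[rshift n k]/(unsplit (inr k)) unsplitK.
Qed.

Context {disp : measure_display} {Omega : measurableType disp}.
Context (X : 'I_(2 * n) -> Omega -> Obs).

Definition first_half (w : Omega) : sample := [ffun k => X (first_ix k) w].

Definition second_half (w : Omega) : sample := [ffun k => X (second_ix k) w].

Lemma freq1E w : freq1 X w = freq R (first_half w).
Proof.
apply/matrixP => i j; rewrite !mxE; congr (_%:R / _).
rewrite -!sum1_card big_mkcond [in RHS]big_mkcond /= big_halves /= [X in (_ + X)%N]big1 ?addn0.
  by apply: eq_bigr => k _; rewrite !inE /first_half ffunE /= ltn_ord.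
by move=> k _; rewrite inE /= ltnNge leq_addr.
Qed.

Lemma freq2E w : freq2 X w = freq R (second_half w).
Proof.
apply/matrixP => i j; rewrite !mxE; congr (_%:R / _).
rewrite -!sum1_card big_mkcond [in RHS]big_mkcond /= big_halves /= [X in (X + _)%N]big1 ?add0n.
  by apply: eq_bigr => k _; rewrite !inE /second_half ffunE /= leq_addr.
by move=> k _; rewrite inE /= leqNgt ltn_ord.
Qed.

Definition halves_event (x : sample * sample) : set Omega :=
  [set w | first_half w = x.1 /\ second_half w = x.2].

Context (P : 'M[R]_(d1, d2)) (Pr : probability Omega R).
Hypothesis iid : iid_sample P Pr X.
Local Notation q := (fun y : Obs => P y.1 y.2).

Lemma halves_eventE x : halves_event x =
  \bigcap_(k in [set` [set: 'I_(2 * n)]%SET]) (X k @^-1` [set join_halves x.1 x.2 k]).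
Proof.
apply/seteqP; split => w /=.
  move=> [h1 h2] k _ /=; rewrite /join_halves.
  case: (fintype.splitP (cast_ord (esym halves_size) k)) => i ki.
    rewrite -h1 /first_half ffunE; congr (X _ w); exact: val_inj.
  rewrite -h2 /second_half ffunE; congr (X _ w); exact: val_inj.
move=> h; split; apply/ffunP => k; rewrite ffunE.
  by rewrite -(join_first x.1 x.2); apply: h; rewrite /= inE.
by rewrite -(join_second x.1 x.2); apply: h; rewrite /= inE.
Qed.

Lemma measurable_halves_event x : measurable (halves_event x).
Proof.
have [mX _ _] := iid; rewrite halves_eventE.
by apply: fin_bigcap_measurable => // k _; exact: mX.
Qed.

Lemma prob_halves_event x : Pr (halves_event x) = (weight q x.1 * weight q x.2)%:E.
Proof.
have [_ law ind] := iid; rewrite halves_eventE ind.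
under eq_bigr do rewrite law.
rewrite -(big_morph EFin (@EFinM R) erefl) (eq_bigl xpredT); last by move=> k; rewrite inE.
rewrite big_halves /=; congr (_ * _)%:E; apply: eq_bigr => k _.
  by rewrite join_first.
by rewrite join_second.
Qed.

(** The observations take finitely many values, so the integrand is a finite
    combination of indicators of the events that fix both halves. *)
Lemma expectation_halves (F : sample -> sample -> R) : (forall x1 x2, 0 <= F x1 x2) ->
  ('E_Pr[fun w => F (first_half w) (second_half w)] =
  (expect q (fun x1 => expect q (F x1)))%:E)%E.
Proof.
move=> F0; rewrite unlock.
have E w : (F (first_half w) (second_half w))%:E =
    (\sum_(x : sample * sample) (F x.1 x.2)%:E * (\1_(halves_event x) w)%:E)%E.
  rewrite (bigD1 (first_half w, second_half w)) //= big1 ?adde0.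
    by rewrite indicE mem_set ?mule1.
  move=> [x1 x2] /= ne; rewrite indicE memNset ?mule0 // => -[h1 h2].
  by move/eqP: ne; apply; rewrite h1 h2.
under eq_integral do rewrite E.
have mI x := measurable_indic (R := R) (D := setT) (measurable_halves_event x).
rewrite ge0_integral_sum //; last 2 first.
- by move=> x; apply: measurable_funeM; apply/measurable_EFinP; exact: mI.
- by move=> x w _; rewrite mule_ge0 // lee_fin.
rewrite /expect; under [in RHS]eq_bigr do rewrite mulr_sumr.
rewrite pair_bigA /= (big_morph EFin (@EFinD R) erefl); apply: eq_bigr => x _.
rewrite ge0_integralZl ?lee_fin //; last by apply/measurable_EFinP; exact: mI.
rewrite integral_indic //; last exact: measurable_halves_event.
by rewrite classical_sets.setIT [X in (_ * X)%E]prob_halves_event -EFinM; congr (_%:E); ring.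
Qed.

End SampleHalves.

(** * The rate *)

(** The summand [3072 * Num.sqrt alpha] comes from the deterministic error,
    [64 * expR 1 + 16] from the two failure probabilities, and
    [4 * Num.sqrt (14 * alpha) + 8] from small samples, where the loss is only
    bounded by [2]. *)
Definition risk_constant (R : realType) (alpha : R) : R :=
  3072 * Num.sqrt alpha + 64 * expR 1 + 4 * Num.sqrt (14 * alpha) + 24.

Lemma sqrn_le_4exp2 m : (m.+1 ^ 2 <= 4 * 2 ^ m)%N.
Proof.
elim: m => // -[//|[//|m]] IH.
have : (m.+4 ^ 2 <= 2 * m.+3 ^ 2)%N by rewrite !expnS !expn0 !muln1; nia.
rewrite (expnS 2 m.+2); lia.
Qed.

Lemma powR_three_halves (R : realType) (L : R) : 0 < L -> L `^ (3 / 2) = L * Num.sqrt L.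
Proof.
move=> L0; have -> : 3 / 2 = 1 + 2^-1 :> R by field.
by rewrite powRD ?powRr1 ?powR12_sqrt ?ltW // (gt_eqF L0) implybT.
Qed.

Section RiskRate.
Context {R : realType} {d1 d2 n K : nat} (alpha : R) (P : 'M[R]_(d1, d2)).
Let d := maxn d1 d2.
Let N := maxn d n.
Let L : R := ln n%:R.
Let x : R := Num.sqrt ((K * d)%:R / n%:R) * (L * Num.sqrt L).
Hypotheses (lawP : is_law P) (rP : (\rank P <= K)%N) (alpha_ge : 3 / 2 <= alpha).
Hypotheses (d1_ge2 : (2 <= d1)%N) (n_ge2 : (2 <= n)%N) (K_ge1 : (1 <= K)%N).
Local Notation sample := {ffun 'I_n -> 'I_d1 * 'I_d2}.
Local Notation q := (fun y : 'I_d1 * 'I_d2 => P y.1 y.2).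

Let risk : R := expect q (fun x1 : sample => expect q (fun x2 : sample =>
    norm1 (alg1 alpha d N n (freq R x1) (freq R x2) - P))).

Lemma split_risk_le2 : risk <= 2.
Proof.
have [P0 P1] := lawP; have n0 : (0 < n)%N := leq_trans (ltn0Sn _) n_ge2.
have q0 y : 0 <= q y by exact: P0.
have q1 := law_sum1 P1.
rewrite -[leRHS](@expect_cst R 'I_n _ q q1); apply: expect_le => // x1.
rewrite -[leRHS](@expect_cst R 'I_n _ q q1); apply: expect_le => // x2.
by apply: alg1_loss_le2 => //; exact: freq_law.
Qed.

Let nR0 : 0 < n%:R :> R. Proof. by rewrite ltr0n (leq_trans _ n_ge2). Qed.
Let d_ge2 : (2 <= d)%N. Proof. by rewrite leq_max d1_ge2. Qed.
Let L_ge : 1 / 2 <= L. Proof. exact: ln_nat_ge_half. Qed.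
Let L0 : 0 < L. Proof. by apply: lt_le_trans L_ge; rewrite divr_gt0. Qed.
Let alpha0 : 0 < alpha. Proof. by apply: lt_le_trans alpha_ge; rewrite divr_gt0. Qed.

Let LsqrtL_ge : 1 <= 4 * (L * Num.sqrt L).
Proof.
have h : 1 / 2 <= Num.sqrt L.
  rewrite -[leLHS]ger0_norm ?divr_ge0 // -sqrtr_sqr ler_wsqrtr //.
  by apply: le_trans L_ge; rewrite expr2; lra.
have l := L_ge; have := ler_pM (_ : 0 <= 1 / 2) (_ : 0 <= 1 / 2) l h.
rewrite divr_ge0 // => /(_ isT isT); lra.
Qed.

Let dn_le (e : R) : 0 <= e -> e <= d%:R / n%:R -> e <= 1 ->
  e <= 4 * x.
Proof.
move=> e0 ed e1; have s1 : Num.sqrt e <= Num.sqrt ((K * d)%:R / n%:R).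
  rewrite ler_wsqrtr // (le_trans ed) // ler_wpM2r ?invr_ge0 ?(ltW nR0) //.
  by rewrite ler_nat leq_pmull.
have se : Num.sqrt e <= 1 by rewrite -[leRHS]sqrtr1 ler_wsqrtr.
have s0 := sqrtr_ge0 e; have a0 := sqrtr_ge0 ((K * d)%:R / n%:R : R).
have h1 : e <= Num.sqrt e.
  by rewrite -{1}(sqr_sqrtr e0) expr2 -[leRHS]mulr1 ler_wpM2l.
apply: (@le_trans _ _ (Num.sqrt ((K * d)%:R / n%:R) * (4 * (L * Num.sqrt L)))).
  by rewrite -[leLHS]mulr1 ler_pM // (le_trans h1).
by rewrite /x mulrCA.
Qed.

(** Below the sample size threshold the rate is bounded from below: either
    [n < d], or [d * ln n / n] is at least [1 / (14 * alpha)]. *)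
Lemma small_sample_rate : n%:R < 14 * alpha * d%:R * ln N%:R ->
  2 <= (4 * Num.sqrt (14 * alpha) + 8) * x.
Proof.
move=> small; have x0 : 0 <= x by rewrite !mulr_ge0 ?sqrtr_ge0 ?ltW.
have LL := LsqrtL_ge.
have b0 : 0 <= Num.sqrt (14 * alpha) := sqrtr_ge0 _.
case: (leqP d n) => [dn|nd]; last first.
  suff : 1 <= 4 * x by have := mulr_ge0 b0 x0; lra.
  rewrite /x mulrCA -[leLHS]mulr1 ler_pM //.
  rewrite -[leLHS]sqrtr1 ler_wsqrtr // ler_pdivlMr // mul1r ler_nat.
  by rewrite (leq_trans (ltnW nd)) // leq_pmull.
suff : 1 <= Num.sqrt (14 * alpha) * (2 * x) by lra.
have NE : N = n by apply/maxn_idPr.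
have -> : Num.sqrt (14 * alpha) * (2 * x) =
    Num.sqrt (14 * alpha * ((K * d)%:R / n%:R * L)) * (2 * L).
  have p1 : 0 <= 14 * alpha by rewrite mulr_ge0 // ltW.
  have p2 : 0 <= (K * d)%:R / n%:R :> R by rewrite divr_ge0.
  rewrite (sqrtrM _ p1) (sqrtrM _ p2) /x; ring.
rewrite -[leLHS]mulr1 ler_pM //; last by have := L_ge; lra.
rewrite -[leLHS]sqrtr1 ler_wsqrtr // mulrA mulrAC mulrA ler_pdivlMr // mul1r.
move: small; rewrite NE -/L natrM => /ltW small; apply: le_trans small _.
have p : 0 <= 14 * alpha * d%:R * L by rewrite !mulr_ge0 // ltW.
have k1 : 1 <= K%:R :> R by rewrite ler1n.
have := ler_wpM2r p k1; congr (_ <= _); ring.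
Qed.

(** Both failure probabilities are at most of order [(d / n) ^+ 2], which is
    dominated by the rate since [d <= n]. *)
Lemma large_sample_rate : 14 * alpha * d%:R * ln N%:R <= n%:R ->
  risk <= (3072 * Num.sqrt alpha + 64 * expR 1 + 16) * x.
Proof.
move=> large; have dR0 : 0 < d%:R :> R by rewrite ltr0n (leq_trans _ d_ge2).
have N_ge2 : (2 <= N)%N by rewrite leq_max n_ge2 orbT.
have dn : (d <= n)%N.
  rewrite -(ler_nat R); apply: le_trans large.
  have lN : 1 / 2 <= ln N%:R :> R := ln_nat_ge_half N_ge2.
  have h1 : 1 <= 14 * alpha * ln N%:R.
    have := ler_pM (_ : 0 <= 3 / 2) (_ : 0 <= 1 / 2) alpha_ge lN.
    rewrite !divr_ge0 // => /(_ isT isT); lra.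
  by rewrite mulrAC -[leLHS]mul1r ler_wpM2r // ltW.
have NE : N = n by apply/maxn_idPr.
have large' : 14 * alpha * d%:R * L <= n%:R by move: large; rewrite NE.
have := split_sample_risk lawP alpha_ge d1_ge2 n_ge2 large' rP.
rewrite -/d -/L => bound; rewrite /risk NE; apply: le_trans bound _.
set T := last_level d; set dd := (d%:R / n%:R : R).
have d01 : 0 <= dd <= 1.
  by rewrite divr_ge0 //= ler_pdivrMr // mul1r ler_nat.
have [d0 d1'] := andP d01.
have dd_le : dd ^+ 2 <= 4 * x.
  have sq_le : dd ^+ 2 <= dd by rewrite expr2 -[leRHS]mulr1 ler_wpM2l.
  by apply: dn_le; [exact: sqr_ge0 | exact: sq_le | exact: le_trans d1'].
have T_le : T.+2%:R <= 4 * L.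
  have h : T.+1%:R * ln 2 <= L.
    rewrite mulr_natl -lnXn // ler_ln ?posrE ?exprn_gt0 // -natrX ler_nat.
    exact: leq_trans (last_level_le d_ge2) dn.
  have l2 : 1 / 2 <= ln 2 :> R := @ln_nat_ge_half R 2 isT.
  have := ler_wpM2l (ler0n R T.+1) l2.
  have : T.+2%:R <= 2 * T.+1%:R :> R by rewrite -natrM ler_nat mul2n -addnn addSnnS leq_addl.
  lra.
have main : 384 * T.+2%:R * Num.sqrt (alpha * (L / n%:R) * (K * d)%:R) <=
    1536 * Num.sqrt alpha * x.
  have -> : alpha * (L / n%:R) * (K * d)%:R = alpha * ((K * d)%:R / n%:R * L).
    by field; rewrite gt_eqF.
  have p2 : 0 <= (K * d)%:R / n%:R :> R by rewrite divr_ge0.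
  rewrite (sqrtrM _ (ltW alpha0)) (sqrtrM _ p2).
  set u := Num.sqrt alpha; set v := Num.sqrt (_ / _); set w := Num.sqrt L.
  have uvw : 0 <= u * (v * w) by rewrite !mulr_ge0 ?sqrtr_ge0.
  have := ler_wpM2r uvw T_le; rewrite /x -/v -/w; lra.
have dsum : (d1 + d2)%:R <= 2 * d%:R :> R.
  by rewrite -natrM ler_nat mul2n -addnn leq_add // ?leq_maxl ?leq_maxr.
have T2 : T.+2%:R ^+ 2 <= 4 * d%:R :> R.
  rewrite -natrX -natrM ler_nat (leq_trans (sqrn_le_4exp2 _)) // leq_mul2l /=.
  exact: last_level_le.
have n2 : 0 <= n%:R ^- 2 :> R by rewrite invr_ge0 exprn_ge0.
have dd2 : d%:R ^+ 2 * n%:R ^- 2 = dd ^+ 2 by rewrite /dd expr_div_n.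
have noise : T.+2%:R ^+ 2 * ((d1 + d2)%:R * (expR 1 * n%:R ^- 2)) <=
    8 * expR 1 * dd ^+ 2.
  have e0 := mulr_ge0 (expR_ge0 (1 : R)) n2.
  rewrite mulrA -dd2; have := ler_wpM2r e0 (ler_pM (exprn_ge0 2 (ler0n R _)) (ler0n R _) T2 dsum).
  move=> h; apply: le_trans h _; rewrite le_eqVlt; apply/orP; left; apply/eqP; ring.
have few : (d1 + d2)%:R * n%:R ^- 2 <= 2 * dd ^+ 2.
  rewrite -dd2; apply: le_trans (ler_wpM2r n2 dsum) _; rewrite mulrA ler_wpM2r //.
  have d1R : 1 <= d%:R :> R by rewrite ler1n ltnW.
  by rewrite ler_wpM2l // expr2 ler_peMl.
have e0 := expR_ge0 (1 : R); have := ler_wpM2l e0 dd_le; lra.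
Qed.

Lemma split_risk_rate : risk <= risk_constant alpha * Num.min x 1.
Proof.
have x0 : 0 <= x by rewrite !mulr_ge0 ?sqrtr_ge0 ?ltW.
have e0 := expR_ge0 (1 : R).
have b1 : 0 <= Num.sqrt alpha := sqrtr_ge0 _.
have b2 : 0 <= Num.sqrt (14 * alpha) := sqrtr_ge0 _.
have r2 := split_risk_le2.
rewrite /risk_constant; case: (leP x 1) => _; last by lra.
have [small|large] := ltP n%:R (14 * alpha * d%:R * ln N%:R).
  have h := small_sample_rate small.
  have := mulr_ge0 b1 x0; have := mulr_ge0 e0 x0; lra.
have h := large_sample_rate large; have := mulr_ge0 b2 x0; lra.
Qed.

End RiskRate.

Theorem theorem4 (R : realType) (alpha : R) (alpha_gt : 3 / 2 < alpha) :
  exists2 C : R, 0 < C &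
  forall (n d1 d2 K : nat),
    (2 <= n)%N -> (2 <= d1)%N -> (2 <= d2)%N -> (1 <= K)%N ->
  let d := maxn d1 d2 in
  let N := maxn d n in
  forall (disp : measure_display) (Omega : measurableType disp)
    (X : 'I_(2 * n) -> Omega -> 'I_d1 * 'I_d2)
    (Pr : 'M[R]_(d1, d2) -> probability Omega R),
    (forall P, low_rank_distributions K P -> iid_sample P (Pr P) X) ->
  let Phat := fun w : Omega => alg1 alpha d N n (freq1 X w) (freq2 X w) in
  (ereal_sup [set 'E_(Pr P)[fun w => norm1 (Phat w - P)]
             | P in low_rank_distributions K]
   <= (C * Num.min (Num.sqrt ((K * d)%:R / n%:R) * (ln n%:R `^ (3 / 2))) 1)%:E)%E.
Proof.
exists (risk_constant alpha).
  rewrite /risk_constant; have := expR_ge0 (1 : R).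
  have := sqrtr_ge0 alpha; have := sqrtr_ge0 (14 * alpha); lra.
move=> n d1 d2 K n2 d1_2 d2_2 K1 d N disp Omega X Pr iid; cbv zeta.
apply: ge_ereal_sup => _ [P lowP <-]; have [rP P0 P1] := lowP.
pose loss (x1 x2 : {ffun 'I_n -> 'I_d1 * 'I_d2}) : R :=
  norm1 (alg1 alpha d N n (freq R x1) (freq R x2) - P).
have -> : (fun w => norm1 (alg1 alpha d N n (freq1 X w) (freq2 X w) - P)) =
    (fun w => loss (first_half X w) (second_half X w)).
  by apply/funext => w; rewrite freq1E freq2E.
rewrite (expectation_halves (iid P lowP) (F := loss)); last by move=> *; exact: norm1_ge0.
have lnp : 0 < ln n%:R :> R by rewrite ln_gt0 // ltr1n.
rewrite lee_fin powR_three_halves //.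
by apply: split_risk_rate => //; exact: ltW.
Qed.
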